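(* Let $N\ge 2$, let $M,M'\subset\mathbb{C}^N$ be formal real hypersurfaces, and assume that $M$ belongs to the class $\mathcal{C}$. Then every formal holomorphic map $H\colon(\mathbb{C}^N,0)\to(\mathbb{C}^N,0)$ sending $M$ into $M'$ which is transversally nonflat is not totally degenerate, and hence is CR-transversal.
   Context: For a formal power series $h(x)$ with complex coefficients, $\bar h(x)$ is the series obtained by conjugating the coefficients (similarly for formal maps). The generic rank of a formal map $F(x)$ is the largest $r$ such that some $r\times r$ minor of the Jacobian matrix $\partial F/\partial x$ is a nonzero formal power series. Formal real hypersurface $M\subset\mathbb{C}^N$ (through $0$): given by $r\in\mathbb{C}[[Z,\zeta]]$, $(Z,\zeta)\in\mathbb{C}^N\times\mathbb{C}^N$, with $\bar r(\zeta,Z)=r(Z,\zeta)$, $r(0)=0$ and $\partial_Z r(0)\neq 0$; $\mathcal{I}(M)$ is the ideal of $\mathbb{C}[[Z,\zeta]]$ generated by $r$, and $T^{1,0}_0M=\ker\partial_Zr(0)\subset T_0\mathbb{C}^N$. Normal coordinates: there is a formal change of coordinates $Z=Z(z,w)$ of $\mathbb{C}^N$, $z\in\mathbb{C}^{N-1}$, $w\in\mathbb{C}$, with associated change $\zeta=\bar Z(\chi,\tau)$, $\chi\in\mathbb{C}^{N-1}$, $\tau\in\mathbb{C}$, such that $M$ is defined by $w-Q(z,\chi,\tau)$, where $Q\in\mathbb{C}[[z,\chi,\tau]]$ satisfies $Q(0,\chi,\tau)=Q(z,0,\tau)=\tau$. Class $\mathcal{C}$: $M$ belongs to the class $\mathcal{C}$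 if, in normal coordinates, for $k$ large enough the formal map $\chi\mapsto\big(Q_{z^\alpha}(0,\chi,0)\big)_{|\alpha|\le k}$ has generic rank $N-1$ (this is independent of the choice of normal coordinates). Maps: a formal holomorphic map $H\colon(\mathbb{C}^N,0)\to(\mathbb{C}^N,0)$ sends $M$ (defined by $r$) into $M'$ (defined by $r'$) if $r'(H(Z),\bar H(\zeta))\in\mathcal{I}(M)$. $H$ is CR-transversal if $T^{1,0}_0M'+dH(T_0\mathbb{C}^N)=T_0\mathbb{C}^N$, where $dH$ is the differential of $H$ at $0$. Choose normal coordinates $(z,w)$ for $M$ and $(z',w')$ for $M'$ and write $H=(F,G)$ with $F$ having $N-1$ components and $G$ scalar. Then $H$ is CR-transversal iff $\partial G/\partial w(0)\ne 0$. $H$ is transversally flat if $G\equiv0$, and transversally nonflat otherwise. $H$ is not totally degenerate if the matrix $\frac{\partial F}{\partial z}(z,0)$ has generic rank $N-1$, i.e. $\det\frac{\partial F}{\partial z}(z,0)\not\equiv 0$. These conditions are independent of the choice of normal coordinates. *)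

(* Defs.v *)
From HB Require Import structures.
From mathcomp Require Import all_boot all_order all_algebra.
From mathcomp Require Import boolp reals.
From mathcomp Require Import complex.
From mathcomp Require Import mpoly.

Set Implicit Arguments.
Unset Strict Implicit.
Unset Printing Implicit Defensive.

Import Order.TTheory GRing.Theory Num.Theory.

Local Open Scope ring_scope.

(** * Formal power series in [n] variables, with the monomials of [mpoly] *)

Record fps (n : nat) (K : Type) := Fps { fcoef : 'X_{1..n} -> K }.

Lemma fpsP n K (f g : fps n K) : fcoef f =1 fcoef g -> f = g.
Proof. by case: f g => [f] [g] /= /funext ->. Qed.

HB.instance Definition _ n K := gen_eqMixin (fps n K).
HB.instance Definition _ n K := gen_choiceMixin (fps n K).

Section FpsRing.
Variables (n : nat) (K : comNzRingType).
Implicit Types f g h : fps n K.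

Definition fps_zero : fps n K := Fps (fun=> 0).
Definition fps_one : fps n K := Fps (fun m => (m == 0%MM)%:R).
Definition fps_opp f : fps n K := Fps (fun m => - fcoef f m).
Definition fps_add f g : fps n K := Fps (fun m => fcoef f m + fcoef g m).
Definition fps_mul f g : fps n K :=
  Fps (fun m => \sum_(k : 'X_{1..n < (mdeg m).+1} | (k <= m)%MM)
                   fcoef f k * fcoef g (m - k)%MM).

Fact fps_addA : associative fps_add.
Proof. by move=> f g h; apply: fpsP => m /=; rewrite addrA. Qed.

Fact fps_addC : commutative fps_add.
Proof. by move=> f g; apply: fpsP => m /=; rewrite addrC. Qed.

Fact fps_add0 : left_id fps_zero fps_add.
Proof. by move=> f; apply: fpsP => m /=; rewrite add0r. Qed.

Fact fps_addN : left_inverse fps_zero fps_opp fps_add.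
Proof. by move=> f; apply: fpsP => m /=; rewrite addNr. Qed.

HB.instance Definition _ :=
  GRing.isZmodule.Build (fps n K) fps_addA fps_addC fps_add0 fps_addN.

Definition ftrunc d f : {mpoly K[n]} :=
  \sum_(m : 'X_{1..n < d}) fcoef f m *: 'X_[m].

Lemma mcoeff_ftrunc d f m : (mdeg m < d)%N -> (ftrunc d f)@_m = fcoef f m.
Proof. exact: mcoeff_mpoly. Qed.

Lemma mcoeffM_eq d (p q p' q' : {mpoly K[n]}) m : (mdeg m < d)%N ->
  (forall k, (mdeg k < d)%N -> p@_k = p'@_k) ->
  (forall k, (mdeg k < d)%N -> q@_k = q'@_k) -> (p * q)@_m = (p' * q')@_m.
Proof.
move=> md hp hq; rewrite !mcoeffM; apply: eq_bigr => -[k1 k2] /= _.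
by rewrite hp ?hq //; apply: leq_trans md; apply: bmdeg.
Qed.

Lemma fcoefM d f g m : (mdeg m < d)%N ->
  fcoef (fps_mul f g) m = (ftrunc d f * ftrunc d g)@_m.
Proof.
move=> md; rewrite [RHS](mcoeff_poly_mul_lin _ _ (ltnSn _)) /=.
apply: eq_bigr => k _; rewrite !mcoeff_ftrunc //.
  by apply: leq_ltn_trans md; apply: mdegB.
by apply: leq_trans md; apply: bmdeg.
Qed.

Fact fps_mulC : commutative fps_mul.
Proof.
by move=> f g; apply: fpsP => m; rewrite !(fcoefM _ _ (ltnSn _)) mulrC.
Qed.

Fact fps_mulA : associative fps_mul.
Proof.
move=> f g h; apply: fpsP => m; set d := (mdeg m).+1.
have md : (mdeg m < d)%N by [].
rewrite !(fcoefM _ _ md).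
rewrite (@mcoeffM_eq d _ _ (ftrunc d f) (ftrunc d g * ftrunc d h)) //; last first.
  by move=> k kd; rewrite mcoeff_ftrunc // (fcoefM _ _ kd).
rewrite mulrA; apply: (@mcoeffM_eq d) => // k kd.
by rewrite mcoeff_ftrunc // (fcoefM _ _ kd).
Qed.

Fact fps_mul1 : left_id fps_one fps_mul.
Proof.
move=> f; apply: fpsP => m; have md := ltnSn (mdeg m).
rewrite (fcoefM _ _ md) (mcoeffM_eq (p' := 1) (q' := ftrunc (mdeg m).+1 f) md) //.
  by rewrite mul1r mcoeff_ftrunc.
by move=> k kd; rewrite mcoeff_ftrunc // mcoeff1.
Qed.

Fact fps_mulD : left_distributive fps_mul fps_add.
Proof.
move=> f g h; apply: fpsP => m /=; rewrite -big_split /=.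
by apply: eq_bigr => k _; rewrite mulrDl.
Qed.

Fact fps_one_neq0 : fps_one != 0.
Proof.
apply/eqP => /(congr1 (fun f => fcoef f 0%MM)) /= /eqP.
by rewrite eqxx oner_eq0.
Qed.

HB.instance Definition _ := GRing.Zmodule_isComNzRing.Build (fps n K)
  fps_mulA fps_mulC fps_mul1 fps_mulD fps_one_neq0.

End FpsRing.

(** * Substitution, derivation, generic rank *)

Section FpsOps.
Variable K : comNzRingType.

Definition fconst n (f : fps n K) : K := fcoef f 0%MM.

Definition fvar n (i : 'I_n) : fps n K := Fps (fun m => (m == U_(i)%MM)%:R).

(* A formal map (C^n, 0) -> (C^p, 0) is given by its components. *)
Definition vanish0 n p (F : 'I_p -> fps n K) := forall i, fconst (F i) = 0.

(* The series f(g_1, ..., g_p).  Only meaningful when all the [g i] have zero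
   constant term: then [\prod_i g i ^+ k i] has order at least [mdeg k], hence
   contributes to the coefficient of [m] only if [mdeg k <= mdeg m]. *)
Definition fsubst n p (f : fps p K) (g : 'I_p -> fps n K) : fps n K :=
  Fps (fun m => \sum_(k : 'X_{1..p < (mdeg m).+1})
                   fcoef f k * fcoef (\prod_i g i ^+ (k : 'X_{1..p}) i) m).

Definition fcomp n p q (F : 'I_q -> fps p K) (G : 'I_p -> fps n K) :
  'I_q -> fps n K := fun i => fsubst (F i) G.

Definition fderiv n (i : 'I_n) (f : fps n K) : fps n K :=
  Fps (fun m => fcoef f (m + U_(i))%MM *+ (m i).+1).

Definition jacobian n p (F : 'I_p -> fps n K) : 'M[fps n K]_(p, n) :=
  \matrix_(i, j) fderiv j (F i).

Definition jacobian0 n p (F : 'I_p -> fps n K) : 'M[K]_(p, n) :=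
  map_mx (@fconst n) (jacobian F).

(* The components are indexed by an arbitrary finite type, and the rows and
   columns of a minor are picked by functions; those that are not injective
   give zero minors. *)
Definition generic_rank n (I : finType) (F : I -> fps n K) : nat :=
  \max_(r < n.+1 |
    [exists s : {ffun 'I_r -> I}, exists t : {ffun 'I_r -> 'I_n},
       \det (\matrix_(i < r, j < r) fderiv (t j) (F (s i))) != 0]) r.

(* Concatenation (u, v) of blocks of variables or of components. *)
Definition vcat T a b (u : 'I_a -> T) (v : 'I_b -> T) : 'I_(a + b) -> T :=
  fun i => match split i with inl j => u j | inr j => v j end.

(* (u, x), with the scalar entry x in the last position [ord_max]. *)
Definition vsnoc T n (u : 'I_n -> T) (x : T) : 'I_n.+1 -> T :=
  fun i => if unlift ord_max i is Some j then u j else x.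

Definition in_ideal n (r f : fps n K) := exists a : fps n K, f = a * r.

End FpsOps.

Definition fconj (C : numClosedFieldType) n (f : fps n C) : fps n C :=
  Fps (fun m => (fcoef f m)^*).

(** * Formal real hypersurfaces of C^N and their normal coordinates *)

Section Hypersurfaces.
Variable R : realType.
Local Notation C := R[i].

(* In [fps (N + N) C] the first [N] variables are Z, the last [N] are zeta. *)
Definition varZ N (i : 'I_N) : fps (N + N) C := fvar C (lshift N i).
Definition varzeta N (i : 'I_N) : fps (N + N) C := fvar C (rshift N i).

Record hypersurface (N : nat) := Hypersurface {
  hdef :> fps (N + N) C;
  hdef_real :
    fsubst (fconj hdef) (vcat (@varzeta N) (@varZ N)) = hdef;
  hdef0 : fconst hdef = 0;
  hdef_dZ : exists i : 'I_N, fconst (fderiv (lshift N i) hdef) != 0 }.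

Definition dZ0 N (M : hypersurface N) : 'cV[C]_N :=
  \col_i fconst (fderiv (lshift N i) M).

(* Tangent vectors are row vectors; this matrix has row space ker dZ0. *)
Definition T10 N (M : hypersurface N) : 'M[C]_N := kermx (dZ0 M).

(* For G, H mapping (C^N, 0) to itself: the map (Z, zeta) |-> (G Z, H zeta). *)
Definition fprod_map N (G H : 'I_N -> fps N C) : 'I_(N + N) -> fps (N + N) C :=
  vcat (fcomp G (@varZ N)) (fcomp H (@varzeta N)).

Definition fmap_conj N (H : 'I_N -> fps N C) : 'I_N -> fps N C :=
  fun i => fconj (H i).

Definition sends N (M M' : hypersurface N) (H : 'I_N -> fps N C) :=
  in_ideal M (fsubst M' (fprod_map H (fmap_conj H))).

Definition CR_transversal N (M' : hypersurface N) (H : 'I_N -> fps N C) :=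
  (T10 M' + (jacobian0 H)^T == 1%:M)%MS.

(* A formal change of coordinates Z = Z(y), together with its inverse y(Z). *)
Record coord_change (N : nat) := CoordChange {
  cc :> 'I_N -> fps N C;
  cc_inv : 'I_N -> fps N C;
  cc0 : vanish0 cc;
  cc_inv0 : vanish0 cc_inv;
  ccK : fcomp cc cc_inv =1 @fvar C N;
  cc_invK : fcomp cc_inv cc =1 @fvar C N }.

(* From here on N = n.+1.  In C^N the coordinates (z, w) are the variables of
   [fps n.+1 C], w being the last one; in [fps (n + n.+1) C] the variables are
   z (first block), then (chi, tau), tau being the last one. *)
Section Normal.
Variable n : nat.
Implicit Types (M : hypersurface n.+1) (Q : fps (n + n.+1) C).

Definition chitau (i : 'I_n.+1) : fps n.+1 C := fvar C i.

(* Q(z, chi, tau) as a series in ((z, w), (chi, tau)), not depending on w. *)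
Definition Qlift Q : fps (n.+1 + n.+1) C :=
  fsubst Q (vcat (fun j => @varZ n.+1 (lift ord_max j)) (@varzeta n.+1)).

Definition normal_coord M (Z : coord_change n.+1) Q :=
  [/\ (* Q(0, chi, tau) = tau, in the variables (chi, tau) *)
      fsubst Q (vcat (fun=> 0) chitau) = chitau ord_max,
      (* Q(z, 0, tau) = tau, in the variables (z, tau) *)
      fsubst Q (vcat (fun j => fvar C (lift ord_max j))
                     (vsnoc (fun=> 0) (fvar C ord_max)))
        = fvar C (ord_max : 'I_n.+1)
    & (* r(Z(z, w), bar Z(chi, tau)) and w - Q generate the same ideal *)
      forall f : fps (n.+1 + n.+1) C,
        in_ideal (fsubst M (fprod_map Z (fmap_conj Z))) f <->
        in_ideal (@varZ n.+1 ord_max - Qlift Q) f].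

Definition fderiv_z (alpha : 'X_{1..n}) Q : fps (n + n.+1) C :=
  foldr (fun i f => iter (alpha i) (fderiv (lshift n.+1 i)) f) Q (enum 'I_n).

(* Q_{z^alpha}(0, chi, 0) *)
Definition Qz0 Q (alpha : 'X_{1..n}) : fps n C :=
  fsubst (fderiv_z alpha Q) (vcat (fun=> 0) (vsnoc (@fvar C n) 0)).

Definition class_C M :=
  exists (Z : coord_change n.+1) Q, normal_coord M Z Q /\
    exists k0, forall k, (k0 <= k)%N ->
      generic_rank (fun alpha : 'X_{1..n < k.+1} => Qz0 Q alpha) = n.

Definition in_coord (Z Z' : coord_change n.+1) (H : 'I_n.+1 -> fps n.+1 C) :
  'I_n.+1 -> fps n.+1 C := fcomp (cc_inv Z') (fcomp H Z).

Definition mapF (H : 'I_n.+1 -> fps n.+1 C) (i : 'I_n) : fps n.+1 C :=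
  H (lift ord_max i).
Definition mapG (H : 'I_n.+1 -> fps n.+1 C) : fps n.+1 C := H ord_max.

(* (dF/dz)(z, 0) *)
Definition Fz0 (H : 'I_n.+1 -> fps n.+1 C) : 'M[fps n C]_n :=
  \matrix_(i, j) fsubst (fderiv (lift ord_max j) (mapF H i))
                        (vsnoc (@fvar C n) 0).

(* The next two notions do not depend on the choice of normal coordinates.
   The quantifiers are such that the negation of the first one holds as soon
   as G <> 0 in one choice, while the negation of the second one asserts that
   the determinant is nonzero in every choice. *)
Definition transversally_flat M M' (H : 'I_n.+1 -> fps n.+1 C) :=
  forall Z Q Z' Q', normal_coord M Z Q -> normal_coord M' Z' Q' ->
    mapG (in_coord Z Z' H) = 0.

Definition totally_degenerate M M' (H : 'I_n.+1 -> fps n.+1 C) :=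
  exists Z Q Z' Q', [/\ normal_coord M Z Q, normal_coord M' Z' Q' &
    \det (Fz0 (in_coord Z Z' H)) = 0].

End Normal.
End Hypersurfaces.

(* Main.v *)
(** In normal coordinates the hypothesis reads rho'(h, hbar) = a rho, where
    rho = w - Q(z, chi, tau), h = (F, G), and G(z, 0) = 0.  Put
    R(z, chi) = Q(z, chi, 0), so that (z, R, chi, 0) lies on M.

    If det F_z(z, 0) = 0, a nonzero vector field X in chi kills Fbar(chi, 0).
    Then X - (X R) d/dw kills both w + R and every component of the map at
    (z, w + R, chi, 0), hence it kills E = rho'(h, hbar) at that point, which
    is divisible by w.  The class C hypothesis gives X R <> 0, so comparing
    lowest powers of w yields E = 0, and chi = 0 gives G = 0.

    If delta = det F_z(z, 0) <> 0, let J = X G for the field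
    X = - (adj(F_z) F_w) d/dz + det(F_z) d/dw, which is tangent to the fibres
    of F; G <> 0 implies J <> 0.  Applying X and its conjugate to the equation
    and restricting to (z, R, chi, 0) gives J(z, R) = b k1 and
    u Jbar(chi, 0) = - b k2, where b is the restriction of a, k2(0, chi) =
    - deltabar(chi) and u(0, chi) = 1; hence Jbar(chi, 0) = b(0, chi)
    deltabar(chi).  Comparing orders in chi forces b(0) <> 0, that is
    a(0) <> 0, and then the gradient of r'(H, Hbar) at 0 does not vanish. *)

From HB Require Import structures.
Require Import Defs.
From mathcomp Require Import all_boot all_order all_algebra.
From mathcomp Require Import boolp reals complex mpoly.
From mathcomp Require Import ring zify.

Set Implicit Arguments.
Unset Strict Implicit.
Unset Printing Implicit Defensive.

Import Order.TTheory GRing.Theory Num.Theory.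

Local Open Scope ring_scope.

(** * Substitution and derivation of formal power series *)

Section FpsTheory.
Variable K : comNzRingType.

Section OneRing.
Variable n : nat.
Implicit Types (f g h : fps n K) (m : 'X_{1..n}).

Lemma fcoefD f g m : fcoef (f + g) m = fcoef f m + fcoef g m.
Proof. by []. Qed.
Lemma fcoefB f g m : fcoef (f - g) m = fcoef f m - fcoef g m.
Proof. by []. Qed.
Lemma fcoef0 m : fcoef (0 : fps n K) m = 0.
Proof. by []. Qed.
Lemma fcoef1 m : fcoef (1 : fps n K) m = (m == 0%MM)%:R.
Proof. by []. Qed.

Definition coef_at m f := fcoef f m.
Fact coef_at_is_additive m : zmod_morphism (coef_at m).
Proof. by []. Qed.
HB.instance Definition _ m := GRing.isZmodMorphism.Build (fps n K) K
  (coef_at m) (coef_at_is_additive m).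

Lemma fcoef_sum I (r : seq I) (P : pred I) (F : I -> fps n K) m :
  fcoef (\sum_(i <- r | P i) F i) m = \sum_(i <- r | P i) fcoef (F i) m.
Proof. exact: (raddf_sum (coef_at m)). Qed.


Lemma fcoef_mulE d f g m : (mdeg m < d)%N ->
  fcoef (f * g) m = (ftrunc d f * ftrunc d g)@_m.
Proof. exact: fcoefM. Qed.

(** Congruence modulo the [d]-th power of the maximal ideal. Through [agree_eq], identities between
    series are checked on polynomial truncations, where the theory of [mpoly] applies. *)
Definition agree d f g := forall m, (mdeg m < d)%N -> fcoef f m = fcoef g m.

Lemma agreeW d e f g : (e <= d)%N -> agree d f g -> agree e f g.
Proof. by move=> ed fg m me; apply: fg; apply: leq_trans ed. Qed.

Lemma agree_eq f g : (forall d, agree d f g) -> f = g.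
Proof. by move=> fg; apply: fpsP => m; apply: (fg (mdeg m).+1). Qed.

Lemma agreeM d f f' g g' : agree d f f' -> agree d g g' ->
  agree d (f * g) (f' * g').
Proof.
move=> ff gg m md; rewrite !(fcoef_mulE _ _ md).
by apply: mcoeffM_eq (md) _ _ => k kd; rewrite !mcoeff_ftrunc // ?ff ?gg.
Qed.

Definition fpoly (p : {mpoly K[n]}) : fps n K := Fps (fun m => p@_m).

Lemma fpoly_is_additive : zmod_morphism fpoly.
Proof. by move=> p q; apply: fpsP => m /=; rewrite mcoeffB. Qed.
HB.instance Definition _ := GRing.isZmodMorphism.Build {mpoly K[n]} (fps n K)
  fpoly fpoly_is_additive.

Lemma fpoly_is_multiplicative : monoid_morphism fpoly.
Proof.
split=> [|p q]; apply: fpsP => m; first by rewrite /= mcoeff1.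
rewrite (fcoef_mulE _ _ (ltnSn _)) /=.
by apply: mcoeffM_eq (ltnSn _) _ _ => k kd; rewrite mcoeff_ftrunc.
Qed.
HB.instance Definition _ := GRing.isMonoidMorphism.Build {mpoly K[n]} (fps n K)
  fpoly fpoly_is_multiplicative.

Lemma fvar_fpoly (i : 'I_n) : fvar K i = fpoly 'X_i.
Proof. by apply: fpsP => m /=; rewrite mcoeffX eq_sym. Qed.

Lemma agree_ftrunc d f : agree d (fpoly (ftrunc d f)) f.
Proof. by move=> m md; rewrite /= mcoeff_ftrunc. Qed.

Definition fC (c : K) : fps n K := fpoly c%:MP.
HB.instance Definition _ := GRing.RMorphism.copy fC (fpoly \o @mpolyC n K).

Lemma fcoefC c m : fcoef (fC c) m = c *+ (m == 0%MM).
Proof. by rewrite /= mcoeffC mulr_natr. Qed.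

Lemma fcoefCM c f m : fcoef (fC c * f) m = c * fcoef f m.
Proof.
have md := ltnSn (mdeg m).
have /(_ _ md) : agree (mdeg m).+1 (fpoly (c *: ftrunc (mdeg m).+1 f)) (fC c * f).
  rewrite -mul_mpolyC rmorphM /=; apply: agreeM => //; exact: agree_ftrunc.
by move=> <- /=; rewrite mcoeffZ mcoeff_ftrunc.
Qed.

Lemma fconst_is_additive : zmod_morphism (@fconst K n).
Proof. by []. Qed.
HB.instance Definition _ := GRing.isZmodMorphism.Build (fps n K) K
  (@fconst K n) fconst_is_additive.

Lemma fconst_is_multiplicative : monoid_morphism (@fconst K n).
Proof.
split=> [|f g]; first by rewrite /fconst fcoef1 eqxx.
have /(_ 0%MM) : agree 1 (f * g) (fC (fconst f) * g).
  apply: agreeM => // m; rewrite ltnS leqn0 mdeg_eq0 => /eqP ->.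
  by rewrite fcoefC eqxx.
by rewrite mdeg0 fcoefCM; apply.
Qed.
HB.instance Definition _ := GRing.isMonoidMorphism.Build (fps n K) K
  (@fconst K n) fconst_is_multiplicative.


Definition ordge d f := agree d f 0.

Lemma agreeB d f g : agree d f g <-> ordge d (f - g).
Proof.
split=> fg m md; first by rewrite fcoefB fg // subrr.
by apply/eqP; rewrite -subr_eq0 -fcoefB fg.
Qed.

Lemma ordgeD d f g : ordge d f -> ordge d g -> ordge d (f + g).
Proof. by move=> hf hg m md; rewrite fcoefD hf // hg // addr0. Qed.

Lemma ordge_sum d I (r : seq I) (P : pred I) (F : I -> fps n K) :
  (forall i, P i -> ordge d (F i)) -> ordge d (\sum_(i <- r | P i) F i).
Proof. by move=> h; apply: (big_ind (ordge d)) => //; exact: ordgeD. Qed.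

Lemma ordgeM d e f g : ordge d f -> ordge e g -> ordge (d + e) (f * g).
Proof.
move=> hf hg m md; rewrite fcoef0 (fcoef_mulE _ _ (ltnSn _)) mcoeffM big1 //.
move=> -[k1 k2] /= /eqP mk; rewrite !mcoeff_ftrunc ?bmdeg //.
have [k1d|dk1] := ltnP (mdeg k1) d; first by rewrite hf // mul0r.
rewrite [X in _ * X]hg ?mulr0 //.
have : (mdeg k1 + mdeg k2 < d + e)%N by rewrite -mdegD -mk.
lia.
Qed.

Lemma ordgeMl d f g : ordge d g -> ordge d (f * g).
Proof. by rewrite -[d]add0n; apply: ordgeM. Qed.

Lemma ordge_exp f k : fconst f = 0 -> ordge k (f ^+ k).
Proof.
move=> f0; elim: k => [//|k IH]; rewrite exprS -add1n; apply: ordgeM IH.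
by move=> m; rewrite ltnS leqn0 mdeg_eq0 => /eqP ->.
Qed.

Lemma ordge_mmap1 p (g : 'I_p -> fps n K) (k : 'X_{1..p}) : vanish0 g ->
  ordge (mdeg k) (mmap1 g k).
Proof.
move=> vg; rewrite /mmap1 mdegE.
elim/big_rec2: _ => [//|i d f _ hf]; apply: ordgeM hf.
by apply: ordge_exp.
Qed.

End OneRing.

(** * Substitution, computed on polynomial truncations *)

Section Substitution.
Variables (n p : nat).
Implicit Types (f : fps p K) (g : 'I_p -> fps n K).

Definition peval g (q : {mpoly K[p]}) : fps n K := mmap (@fC n) g q.
HB.instance Definition _ g := GRing.RMorphism.copy (peval g) (mmap (@fC n) g).

Lemma peval_ordge d g (q : {mpoly K[p]}) : vanish0 g ->
  (forall k, (mdeg k < d)%N -> q@_k = 0) -> ordge d (peval g q).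
Proof.
move=> vg hq; apply: ordge_sum => k _; have [/hq ->|dk] := ltnP (mdeg k) d.
  by rewrite rmorph0 mul0r.
by apply: ordgeMl; apply: agreeW dk _; exact: ordge_mmap1.
Qed.

Lemma fsubst_trunc f g m :
  fcoef (fsubst f g) m = fcoef (peval g (ftrunc (mdeg m).+1 f)) m.
Proof.
rewrite /ftrunc rmorph_sum fcoef_sum /=; apply: eq_bigr => k _.
by rewrite /peval mmapZ mmapX fcoefCM.
Qed.

(** Since the [g i] have no constant term, a monomial of degree [k] is sent to order at least [k];
    hence modulo order [d] any polynomial with the same coefficients as [f] below degree [d]
    computes the substitution. The ring morphism laws and associativity are read off from polynomial
    evaluation in this way. *)
Lemma agree_fsubst_peval d f g q : vanish0 g ->
  (forall k, (mdeg k < d)%N -> q@_k = fcoef f k) ->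
  agree d (fsubst f g) (peval g q).
Proof.
move=> vg hq m md; rewrite fsubst_trunc.
apply: (_ : agree (mdeg m).+1 _ _) => //; apply/agreeB.
rewrite -rmorphB; apply: peval_ordge => // k km.
by rewrite mcoeffB mcoeff_ftrunc // hq ?subrr // (leq_trans km).
Qed.

Lemma agree_fsubst d f f' g : vanish0 g -> agree d f f' ->
  agree d (fsubst f g) (fsubst f' g).
Proof.
move=> vg ff m md.
have hf := @agree_fsubst_peval d f g (ftrunc d f) vg.
have hf' := @agree_fsubst_peval d f' g (ftrunc d f) vg.
rewrite hf ?hf' // => k kd; rewrite mcoeff_ftrunc //; exact: ff.
Qed.

Lemma fsubst_fpoly g q : vanish0 g -> fsubst (fpoly q) g = peval g q.
Proof. by move=> vg; apply: agree_eq => d; apply: agree_fsubst_peval. Qed.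

Lemma fsubst_is_additive g : zmod_morphism (fun f => fsubst f g).
Proof.
move=> f f'; apply: fpsP => m /=; rewrite -sumrB.
by apply: eq_bigr => k _; rewrite mulrBl.
Qed.

Lemma fsubstC g c : vanish0 g -> fsubst (fC p c) g = fC n c.
Proof. by move=> vg; rewrite fsubst_fpoly // /peval mmapC. Qed.

Lemma fsubst_is_multiplicative g : vanish0 g ->
  monoid_morphism (fun f => fsubst f g).
Proof.
move=> vg; split=> [|f f']; first by rewrite -[1](rmorph1 (fC p)) fsubstC ?rmorph1.
apply: agree_eq => d m md.
rewrite (@agree_fsubst_peval d _ _ (ftrunc d f * ftrunc d f')) //; last first.
  by move=> k kd; rewrite (fcoef_mulE _ _ kd).
rewrite rmorphM; symmetry.
by apply: (@agreeM _ d) => //; apply: agree_fsubst_peval => // k; exact: mcoeff_ftrunc.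
Qed.

Lemma fsubst_var g i : vanish0 g -> fsubst (fvar K i) g = g i.
Proof.
by move=> vg; rewrite fvar_fpoly fsubst_fpoly // /peval mmapX mmap1U.
Qed.

Lemma eq_fsubst f g g' : g =1 g' -> fsubst f g = fsubst f g'.
Proof. by move=> /funext ->. Qed.

Lemma fconst_fsubst f g : vanish0 g -> fconst (fsubst f g) = fconst f.
Proof.
move=> vg; have /(_ 0%MM) : agree 1 (fsubst f g) (fsubst (fC p (fconst f)) g).
  apply: agree_fsubst => // m; rewrite ltnS leqn0 mdeg_eq0 => /eqP ->.
  by rewrite fcoefC eqxx.
by rewrite mdeg0 fsubstC // fcoefC eqxx; apply.
Qed.

(* Packs the hypothesis [vanish0 g], under which [fsubst^~ g] is a morphism. *)
Definition subst_rm g (vg : vanish0 g) f := fsubst f g.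

HB.instance Definition _ g (vg : vanish0 g) :=
  GRing.isZmodMorphism.Build (fps p K) (fps n K) (subst_rm vg)
    (fsubst_is_additive g).
HB.instance Definition _ g (vg : vanish0 g) :=
  GRing.isMonoidMorphism.Build (fps p K) (fps n K) (subst_rm vg)
    (fsubst_is_multiplicative vg).

End Substitution.
End FpsTheory.

(** * Composition of substitutions *)

Section Compose.
Variable K : comNzRingType.

Section Sums.
Variables (n p : nat) (g : 'I_p -> fps n K).
Hypothesis vg : vanish0 g.

Lemma fsubstD f f' : fsubst (f + f') g = fsubst f g + fsubst f' g.
Proof. exact: (rmorphD (subst_rm vg)). Qed.
Lemma fsubstN f : fsubst (- f) g = - fsubst f g.
Proof. exact: (rmorphN (subst_rm vg)). Qed.
Lemma fsubstB f f' : fsubst (f - f') g = fsubst f g - fsubst f' g.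
Proof. exact: (rmorphB (subst_rm vg)). Qed.
Lemma fsubstM f f' : fsubst (f * f') g = fsubst f g * fsubst f' g.
Proof. exact: (rmorphM (subst_rm vg)). Qed.
Lemma fsubst0 : fsubst 0 g = 0.
Proof. exact: (rmorph0 (subst_rm vg)). Qed.
Lemma fsubst1 : fsubst 1 g = 1.
Proof. exact: (rmorph1 (subst_rm vg)). Qed.
Lemma fsubst_sum I (r : seq I) (P : pred I) F :
  fsubst (\sum_(i <- r | P i) F i) g = \sum_(i <- r | P i) fsubst (F i) g.
Proof. exact: (rmorph_sum (subst_rm vg)). Qed.
Lemma fsubst_det k (A : 'M[fps p K]_k) :
  fsubst (\det A) g = \det (map_mx (fun f => fsubst f g) A).
Proof. exact: esym (det_map_mx (subst_rm vg) A). Qed.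

End Sums.

Lemma vanish0_var n : vanish0 (@fvar K n).
Proof. by move=> i; rewrite /fconst /= eq_sym mnm1_eq0. Qed.

Lemma fconst_var n (i : 'I_n) : fconst (fvar K i) = 0.
Proof. exact: vanish0_var. Qed.

Lemma vanish0_fcomp n p q (F : 'I_q -> fps p K) (G : 'I_p -> fps n K) :
  vanish0 F -> vanish0 G -> vanish0 (fcomp F G).
Proof. by move=> vF vG i; rewrite /fcomp fconst_fsubst. Qed.

Lemma vanish0_vcat n a b (u : 'I_a -> fps n K) (v : 'I_b -> fps n K) :
  vanish0 u -> vanish0 v -> vanish0 (vcat u v).
Proof. by move=> vu vv i; rewrite /vcat; case: split. Qed.

Lemma vanish0_vsnoc n a (u : 'I_a -> fps n K) x :
  vanish0 u -> fconst x = 0 -> vanish0 (vsnoc u x).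
Proof. by move=> vu vx i; rewrite /vsnoc; case: unlift. Qed.

Lemma vanish00 n a : vanish0 (fun _ : 'I_a => 0 : fps n K).
Proof. by move=> i; rewrite rmorph0. Qed.

Lemma fsubstA n p q (f : fps q K) (g : 'I_q -> fps p K) (h : 'I_p -> fps n K) :
  vanish0 g -> vanish0 h -> fsubst (fsubst f g) h = fsubst f (fcomp g h).
Proof.
move=> vg vh; apply: agree_eq => d m md.
have tf k : (mdeg k < d)%N -> (ftrunc d f)@_k = fcoef f k by exact: mcoeff_ftrunc.
rewrite (agree_fsubst_peval (vanish0_fcomp vg vh) tf md).
rewrite (agree_fsubst vh (agree_fsubst_peval vg tf) md).
congr fcoef; rewrite /peval /mmap fsubst_sum //; apply: eq_bigr => k _.
rewrite fsubstM // fsubstC //; congr (_ * _); rewrite /mmap1.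
rewrite [LHS](rmorph_prod (subst_rm vh)); apply: eq_bigr => i _.
by rewrite rmorphXn.
Qed.

Lemma fsubst_id n (f : fps n K) : fsubst f (@fvar K n) = f.
Proof.
apply: agree_eq => d m md.
have tf k : (mdeg k < d)%N -> (ftrunc d f)@_k = fcoef f k by exact: mcoeff_ftrunc.
rewrite (agree_fsubst_peval (@vanish0_var n) tf md).
suff -> : peval (@fvar K n) (ftrunc d f) = fpoly (ftrunc d f).
  by rewrite /= mcoeff_ftrunc.
rewrite /peval; elim/mpolyind: (ftrunc d f) => [|c k q _ _ IH].
  by rewrite !rmorph0.
rewrite mmapD IH rmorphD; congr (_ + _).
rewrite mmapZ -mul_mpolyC rmorphM; congr (_ * _).
rewrite mmapX mpolyXE_id [RHS]rmorph_prod; apply: eq_bigr => i _.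
by rewrite fvar_fpoly rmorphXn.
Qed.

End Compose.

#[export] Hint Resolve vanish0_var vanish00 fconst_var : core.

(** * Partial derivatives, vector fields and the chain rule *)

Section Derivation.
Variable K : comNzRingType.

Section OneRing.
Variable n : nat.
Implicit Types (f g : fps n K) (i j : 'I_n).

Lemma fderiv_is_additive i : zmod_morphism (@fderiv K n i).
Proof. by move=> f g; apply: fpsP => m /=; rewrite mulrnBl. Qed.
HB.instance Definition _ i := GRing.isZmodMorphism.Build (fps n K) (fps n K)
  (@fderiv K n i) (fderiv_is_additive i).

Lemma fderivD i f g : fderiv i (f + g) = fderiv i f + fderiv i g.
Proof. exact: raddfD. Qed.
Lemma fderiv0 i : fderiv i (0 : fps n K) = 0.
Proof. exact: raddf0. Qed.

Lemma fderiv_fpoly i (q : {mpoly K[n]}) : fderiv i (fpoly q) = fpoly q^`M(i).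
Proof. by apply: fpsP => m /=; rewrite mcoeff_deriv. Qed.

Lemma agree_fderiv d i f g : agree d.+1 f g -> agree d (fderiv i f) (fderiv i g).
Proof. by move=> fg m md /=; rewrite fg // mdegD mdeg1 addn1. Qed.

Lemma fderivM i f g : fderiv i (f * g) = fderiv i f * g + f * fderiv i g.
Proof.
apply: agree_eq => d m md.
have a k (h : fps n K) : agree k h (fpoly (ftrunc k h)) by move=> ? ?; rewrite agree_ftrunc.
(* A derivative loses one order of agreement, hence truncations at [d.+1]. *)
rewrite (agree_fderiv i (agreeM (a d.+1 f) (a d.+1 g))) //.
have E (p q : {mpoly K[n]}) : fpoly (p * q) = fpoly p * fpoly q by exact: rmorphM.
have D (p q : {mpoly K[n]}) : fpoly (p + q) = fpoly p + fpoly q by exact: rmorphD.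
rewrite -E fderiv_fpoly mderivM D !E -!fderiv_fpoly.
rewrite 2!fcoefD; have b (h : fps n K) : agree d (fpoly (ftrunc d.+1 h)) h.
  by apply: agreeW (leqnSn d) _; apply: agree_ftrunc.
congr (_ + _); apply: (@agreeM _ _ d) => //; apply: agree_fderiv;
  exact: agree_ftrunc.
Qed.

Lemma fderivC i (c : K) : fderiv i (fC n c) = 0.
Proof. by rewrite fderiv_fpoly mderivC rmorph0. Qed.


Lemma mderivU i j : ('X_j : {mpoly K[n]})^`M(i) = (j == i)%:R.
Proof.
rewrite mderivX mnm1E; case: eqVneq => [->|_]; last by rewrite scale0r.
rewrite scale1r (_ : U_(i) - U_(i) = 0)%MM ?mpolyX0 //.
by apply/mnmP => k; rewrite mnmBE subnn mnm0E.
Qed.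

Lemma fderiv_var i j : fderiv i (fvar K j) = (i == j)%:R.
Proof.
rewrite fvar_fpoly fderiv_fpoly mderivU eq_sym; case: eqP => _; last by rewrite rmorph0.
by rewrite rmorph1.
Qed.

Lemma fderiv_comm i j f : fderiv i (fderiv j f) = fderiv j (fderiv i f).
Proof.
apply: fpsP => m /=; rewrite -!addmA [(U_(i) + U_(j))%MM]addmC.
rewrite !mnmDE !mnm1E eq_sym; case: eqVneq => [->|_] //.
by rewrite !addn0 -!mulrnA mulnC.
Qed.

Definition fD (c : 'I_n -> fps n K) f := \sum_i c i * fderiv i f.

Lemma fD_is_additive c : zmod_morphism (fD c).
Proof.
by move=> f g; rewrite /fD -sumrB; apply: eq_bigr => i _; rewrite raddfB mulrBr.
Qed.
HB.instance Definition _ c := GRing.isZmodMorphism.Build (fps n K) (fps n K)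
  (fD c) (fD_is_additive c).

Lemma fDM c f g : fD c (f * g) = fD c f * g + f * fD c g.
Proof.
rewrite /fD mulr_suml mulr_sumr -big_split; apply: eq_bigr => i _ /=.
by rewrite fderivM mulrDr mulrA [f * (_ * _)]mulrCA.
Qed.

Lemma fD_var c i : fD c (fvar K i) = c i.
Proof.
rewrite /fD (bigD1 i) //= fderiv_var eqxx mulr1 big1 ?addr0 // => j ji.
by rewrite fderiv_var (negPf ji) mulr0.
Qed.

End OneRing.

(** The chain rule. Modulo order [d] only the truncation of [f] at [d.+1] matters; for polynomials
    the identity holds on constants and variables and is stable under products and sums. *)
Lemma fderiv_fsubst n p (f : fps p K) (g : 'I_p -> fps n K) j : vanish0 g ->
  fderiv j (fsubst f g) = \sum_i fsubst (fderiv i f) g * fderiv j (g i).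
Proof.
move=> vg; apply: agree_eq => d m md.
have tf k : (mdeg k < d.+1)%N -> (ftrunc d.+1 f)@_k = fcoef f k.
  exact: mcoeff_ftrunc.
rewrite (agree_fderiv j (agree_fsubst_peval vg tf)) // fcoef_sum.
have -> : \sum_i fcoef (fsubst (fderiv i f) g * fderiv j (g i)) m =
          \sum_i fcoef (peval g (ftrunc d.+1 f)^`M(i) * fderiv j (g i)) m.
  apply: eq_bigr => i _; apply: (@agreeM _ _ d) => //.
  rewrite -fsubst_fpoly // -fderiv_fpoly; apply: agree_fsubst => //.
  by apply: agree_fderiv => k kd; rewrite /= mcoeff_ftrunc.
rewrite -fcoef_sum; congr fcoef; move: (ftrunc d.+1 f) => q.
pose P q := fderiv j (peval g q) = \sum_i peval g q^`M(i) * fderiv j (g i).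
have eM p1 p2 : peval g (p1 * p2) = peval g p1 * peval g p2 by exact: rmorphM.
have eD p1 p2 : peval g (p1 + p2) = peval g p1 + peval g p2 by exact: rmorphD.
have PM q1 q2 : P q1 -> P q2 -> P (q1 * q2).
  rewrite /P eM fderivM => -> ->; rewrite mulr_suml mulr_sumr -big_split.
  by apply: eq_bigr => i _; rewrite mderivM eD !eM /=; ring.
have PC c : P c%:MP.
  rewrite /P /peval mmapC fderivC big1 // => i _.
  by rewrite mderivC rmorph0 mul0r.
have PX i : P 'X_i.
  rewrite /P (bigD1 i) //= big1 => [|k ki].
    by rewrite addr0 mderivU eqxx rmorph1 mul1r /peval mmapX mmap1U.
  by rewrite mderivU eq_sym (negPf ki) rmorph0 mul0r.
rewrite -/(P q); elim/mpolyind: q => [|c k q _ _ IH].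
  by have := PC 0; rewrite mpolyC0.
rewrite /P eD fderivD [fderiv j (peval g q)]IH -mul_mpolyC.
have -> : P (c%:MP * 'X_[k]).
  apply: (PM) => //; rewrite mpolyXE_id; apply: (big_ind P) => //.
    by have := PC 1; rewrite mpolyC1.
  move=> i _; elim: (k i) => [|e IHe].
    by have := PC 1; rewrite mpolyC1 expr0.
  by rewrite exprS; apply: PM.
rewrite -big_split; apply: eq_bigr => i _.
by rewrite !mderivD eD mulrDl.
Qed.

Lemma fD_fsubst n p c (f : fps p K) (g : 'I_p -> fps n K) : vanish0 g ->
  fD c (fsubst f g) = \sum_i fsubst (fderiv i f) g * fD c (g i).
Proof.
move=> vg; rewrite /fD.
transitivity (\sum_j \sum_i fsubst (fderiv i f) g * (c j * fderiv j (g i))).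
  apply: eq_bigr => j _; rewrite fderiv_fsubst // mulr_sumr.
  by apply: eq_bigr => i _; rewrite mulrCA.
by rewrite exchange_big; apply: eq_bigr => i _; rewrite mulr_sumr.
Qed.

Lemma fD_fsubst0 n p c (f : fps p K) (g : 'I_p -> fps n K) : vanish0 g ->
  (forall i, fD c (g i) = 0) -> fD c (fsubst f g) = 0.
Proof.
by move=> vg Dg; rewrite fD_fsubst // big1 // => i _; rewrite Dg mulr0.
Qed.

End Derivation.


(** * Integrality, lowest terms and uniqueness for derivations *)

Section Mask.
Variables (K : comNzRingType) (n : nat).
Implicit Types (f g : fps n K) (P : pred 'I_n).

(** Substituting [fmask P] restricts a series to the coordinate subspace where the variables outside
    [P] vanish. *)
Definition fmask P : 'I_n -> fps n K := fun i => if P i then fvar K i else 0.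

Lemma vanish0_fmask P : vanish0 (fmask P).
Proof. by move=> i; rewrite /fmask; case: ifP. Qed.
Hint Resolve vanish0_fmask : core.

Definition only P (m : 'X_{1..n}) := [forall i, ~~ P i ==> (m i == 0%N)].

Lemma onlyP P (m : 'X_{1..n}) : reflect (forall i, ~~ P i -> m i = 0%N) (only P m).
Proof. by apply: (iffP 'forall_implyP) => h i /h /eqP. Qed.

Lemma prod_fmask P (k : 'X_{1..n}) :
  \prod_i fmask P i ^+ k i = if only P k then fpoly 'X_[k] else 0.
Proof.
case: onlyP => [kP|nkP].
  rewrite mpolyXE_id [RHS]rmorph_prod; apply: eq_bigr => i _.
  rewrite rmorphXn /fmask; have [Pi|/kP ->] := boolP (P i); last by rewrite !expr0.
  by rewrite fvar_fpoly.
case: (pickP (fun i => ~~ P i && (k i != 0%N))) => [i /andP[nPi ki]|h].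
  rewrite (bigD1 i) //= /fmask (negPf nPi).
  by rewrite expr0n (negPf ki) mul0r.
case: nkP => i nPi; apply/eqP; have := h i.
by rewrite nPi /= => /negbFE.
Qed.

Lemma fcoef_fmask P f m :
  fcoef (fsubst f (fmask P)) m = if only P m then fcoef f m else 0.
Proof.
rewrite /= (bigD1 (BMultinom (ltnSn (mdeg m)))) //= [X in _ + X]big1 ?addr0 => [|k km].
  rewrite prod_fmask; case: ifP => _ /=; last by rewrite mulr0.
  by rewrite mcoeffX eqxx mulr1.
rewrite prod_fmask; case: ifP => _ /=; last by rewrite mulr0.
rewrite mcoeffX; case: eqP => [mk|_]; last by rewrite mulr0.
by case/eqP: km; apply: val_inj.
Qed.

(** The quotient of [f] by the variable [t], the monomials free of [t] being dropped. *)
Definition fshift t f : fps n K := Fps (fun m => fcoef f (m + U_(t))%MM).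

Lemma fcoef_varM t f m : fcoef (fvar K t * f) (m + U_(t))%MM = fcoef f m.
Proof.
set d := (mdeg (m + U_(t))%MM).+1.
rewrite (fcoef_mulE _ _ (ltnSn _)) -/d mulrC.
rewrite (@mcoeffM_eq _ _ d _ _ (ftrunc d f) 'X_t) //.
  by rewrite addmC mcoeffMX mcoeff_ftrunc // /d mdegD ltnS leq_addr.
by move=> k kd; rewrite mcoeff_ftrunc // fvar_fpoly.
Qed.

Lemma fmask0_shift t f :
  fsubst f (fmask (predC1 t)) = 0 -> f = fvar K t * fshift t f.
Proof.
move=> f0; apply: fpsP => m; have [mt|mt] := posnP (m t).
  have h (k : 'X_{1..n}) : k t = 0%N -> only (predC1 t) k.
    by move=> kt; apply/onlyP => i; rewrite negbK => /eqP ->.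
  have e (g : fps n K) : fcoef g m = fcoef (fsubst g (fmask (predC1 t))) m.
    by rewrite fcoef_fmask h.
  rewrite e f0 [RHS]e fsubstM // fsubst_var //.
  by have -> : fmask (predC1 t) t = 0; rewrite ?mul0r // /fmask /= eqxx.
have -> : m = (m - U_(t) + U_(t))%MM.
  rewrite submK //; apply/mnm_lepP => i; rewrite mnm1E.
  by case: eqP => [<-|].
by rewrite fcoef_varM.
Qed.

End Mask.
#[export] Hint Resolve vanish0_fmask : core.

(** * Lowest terms with respect to an additive weight *)

Section LowestTerm.
Variables (n : nat) (wt : 'X_{1..n} -> nat).
Hypothesis wtD : forall k l, wt (k + l)%MM = (wt k + wt l)%N.

(** The weight is compared first and the monomial order breaks ties; both are compatible with
    addition, so lowest terms are multiplicative. *)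
Definition low_term (K : comNzRingType) (f : fps n K) m := fcoef f m != 0 /\
  forall k, fcoef f k != 0 -> (wt m < wt k)%N \/ wt m = wt k /\ (m <= k)%O.

Lemma low_term_exists (K : comNzRingType) (f : fps n K) k : fcoef f k != 0 ->
  exists m, low_term f m.
Proof.
move=> fk; pose S w := `[< exists m, fcoef f m != 0 /\ wt m = w >].
have exS : exists w, S w by exists (wt k); apply/asboolP; exists k.
case: (ex_minnP exS) => w /asboolP [k' [fk' wk']] minw.
pose P m := fcoef f m != 0 -> wt m = w -> exists m, low_term f m.
(* Infinitely many monomials may share the minimal weight [w]; a least one is reached by induction
   along the well-founded monomial order. *)
suff : P k' by apply.
apply: (@ltmwf n P) => {fk' wk' k'} m IH fm wm.
have [[l [lm fl wl]]|h] :=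
  pselect (exists l, [/\ (l < m)%O, fcoef f l != 0 & wt l = w]).
  exact: (IH l).
exists m; split=> // l fl; have : (w <= wt l)%N.
  by apply: minw; apply/asboolP; exists l.
rewrite leq_eqVlt => /orP[/eqP wl|wl]; [right|by left; rewrite wm].
split; first by rewrite wm.
by rewrite leNgt; apply/negP => lm; apply: h; exists l.
Qed.

(** In any other contributing splitting [l + l'] of [m + k], neither weight can be below that of
    [m], resp. [k]. The sums agree, so the weights do too, and then [m < l] and [k <= l'] contradict
    compatibility of the order with addition. *)
Lemma fcoefM_low (K : comNzRingType) (f g : fps n K) m k :
  low_term f m -> low_term g k -> fcoef (f * g) (m + k)%MM = fcoef f m * fcoef g k.
Proof.
move=> [fm lf] [gk lg]; rewrite /=.
have mb : (mdeg m < (mdeg (m + k)%MM).+1)%N by rewrite ltnS mdegD leq_addr.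
have mmk : (m <= m + k)%MM by apply/mnm_lepP => i; rewrite mnmDE leq_addr.
rewrite (bigD1 (BMultinom mb)) //= big1 ?addr0 => [|l /andP[lmk nlm]].
  by congr (_ * fcoef g _); apply/mnmP => i; rewrite mnmBE mnmDE addKn.
have [->|fl] := eqVneq (fcoef f l) 0; first by rewrite mul0r.
set l' := (m + k - l)%MM; have [->|gl] := eqVneq (fcoef g l') 0; first by rewrite mulr0.
have E : (l + l' = m + k)%MM by rewrite addmC submK.
have W : (wt l + wt l' = wt m + wt k)%N by rewrite -!wtD E.
have [ml kl] : (m <= l)%O /\ (k <= l')%O.
  by case: (lf _ fl) (lg _ gl) => [?|[? ->]] [?|[? ->]] //; exfalso; lia.
case/eqP: nlm; apply: val_inj => /=; apply/eqP; rewrite eq_le ml andbT leNgt.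
by apply/negP => /ltmc_le_add /(_ kl); rewrite E ltxx.
Qed.

Lemma fcoefM_supp (K : comNzRingType) (f g : fps n K) m : fcoef (f * g) m != 0 ->
  exists k l, [/\ m = (k + l)%MM, fcoef f k != 0 & fcoef g l != 0].
Proof.
move=> fg; apply: contrapT => h; case/eqP: fg; rewrite /= big1 // => k km.
have [->|fk] := eqVneq (fcoef f k) 0; first by rewrite mul0r.
have [->|gk] := eqVneq (fcoef g (m - k)%MM) 0; first by rewrite mulr0.
by case: h; exists k, (m - k)%MM; split=> //; rewrite addmC submK.
Qed.

Lemma fcoefM_low_weight (K : idomainType) (f g : fps n K) p q :
  (exists2 m, fcoef f m != 0 & (wt m <= p)%N) ->
  (exists2 m, fcoef g m != 0 & (wt m <= q)%N) ->
  exists2 m, fcoef (f * g) m != 0 & (wt m <= p + q)%N.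
Proof.
move=> [m0 fm0 m0p] [k0 gk0 k0q].
have [m lm] := low_term_exists fm0; have [k lk] := low_term_exists gk0.
exists (m + k)%MM.
  by rewrite fcoefM_low // mulf_neq0 //; [case: lm|case: lk].
rewrite wtD leq_add //.
  by case: lm => _ /(_ _ fm0) [/ltnW|[->]] // h; apply: leq_trans h _.
by case: lk => _ /(_ _ gk0) [/ltnW|[->]] // h; apply: leq_trans h _.
Qed.

End LowestTerm.

Lemma fps_neq0 n (K : comNzRingType) (f : fps n K) : f != 0 -> exists m, fcoef f m != 0.
Proof.
move=> f0; apply: contrapT => h; case/eqP: f0; apply: fpsP => m.
by apply/eqP/negP => /negP fm; apply: h; exists m.
Qed.

(** * Series over a domain form a domain *)

Section Domain.
Variables (n : nat) (K : idomainType).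

(** Lowest terms for the zero weight, that is for the monomial order alone. *)
Fact fps_integral : GRing.integral_domain_axiom (fps n K).
Proof.
move=> f g fg0; apply/norP => -[/fps_neq0[m fm] /fps_neq0[k gk]].
have [//|||l] := @fcoefM_low_weight n (fun=> 0%N) _ K f g 0 0.
- by exists m.
- by exists k.
by rewrite fg0 eqxx.
Qed.

Definition fps_unit : pred (fps n K) := fun f => `[< exists g, g * f = 1 >].

(** The inverse is picked by classical choice; the value [f] on non-units is the default imposed by
    the unit ring interface. *)
Definition fps_inv (f : fps n K) : fps n K :=
  if pselect (exists g, g * f = 1) is left h then projT1 (cid h) else f.

Fact fps_mulVf : {in fps_unit, left_inverse 1 fps_inv *%R}.
Proof.
move=> f /asboolP uf; rewrite /fps_inv; case: pselect => // h.
by case: (cid h).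
Qed.

Fact fps_unitPl (f g : fps n K) : g * f = 1 -> fps_unit f.
Proof. by move=> h; apply/asboolP; exists g. Qed.

Fact fps_inv_out : {in [predC fps_unit], fps_inv =1 id}.
Proof.
move=> f /negP nf; rewrite /fps_inv; case: pselect => // h.
by case: nf; apply/asboolP.
Qed.

HB.instance Definition _ := GRing.ComNzRing_hasMulInverse.Build (fps n K)
  fps_mulVf fps_unitPl fps_inv_out.
HB.instance Definition _ := GRing.ComUnitRing_isIntegral.Build (fps n K)
  fps_integral.

End Domain.

(** * Uniqueness for vector fields and for restrictions to graphs *)

Section Uniqueness.
Variables (K : numDomainType) (n : nat).
Implicit Types (c : 'I_n -> fps n K) (f : fps n K).

Lemma fps_natS_neq0 k : (k.+1%:R : fps n K) != 0.
Proof.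
apply/eqP => /(congr1 (@fconst K n)); rewrite rmorph_nat rmorph0 => /eqP.
by rewrite pnatr_eq0.
Qed.

Lemma fvar_neq0 (t : 'I_n) : fvar K t != 0.
Proof.
apply/eqP => /(congr1 (fun f => fcoef f U_(t)%MM)) /eqP.
by rewrite /= eqxx oner_eq0.
Qed.

Lemma fcoef_fmask_eq0 t f (m : 'X_{1..n}) : fsubst f (fmask K (predC1 t)) = 0 ->
  m t = 0%N -> fcoef f m = 0.
Proof.
move=> f0 mt; have := fcoef_fmask (predC1 t) f m; rewrite f0.
by case: onlyP => [_ <- //|[] i]; rewrite negbK => /eqP ->.
Qed.

(* Euler-type form of the induction: dividing f by the variable t raises k. *)
Lemma flow_coef_eq0 c t e : fsubst (c t) (fmask K (predC1 t)) != 0 ->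
  forall k f, fvar K t * fD c f + k.+1%:R * (c t * f) = 0 ->
  forall m : 'X_{1..n}, m t = e -> fcoef f m = 0.
Proof.
move=> ct; elim: e => [|e IH] k f Df m mt.
(* Setting the variable [t] to zero removes the first summand of the equation; [k.+1] and the
   restricted [c t] are nonzero and can be cancelled. *)
all: have f0 : fsubst f (fmask K (predC1 t)) = 0.
1,3: apply/eqP; have /eqP := congr1 (fun g => fsubst g (fmask K (predC1 t))) Df.
1,2: rewrite fsubst0 // fsubstD // !fsubstM // fsubst_var //.
1,2: rewrite {1}/fmask /= eqxx mul0r add0r !mulf_eq0 (negPf ct) /=.
1,2: rewrite [fsubst _%:R _](rmorph_nat (subst_rm (@vanish0_fmask _ _ _))).
1,2: by rewrite (negPf (fps_natS_neq0 _)).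
  exact: (fcoef_fmask_eq0 f0).
have fE := fmask0_shift f0; set g := fshift t f in fE.
(* With [f = t g], the extra summand [c t * g] of the Leibniz rule raises the constant by one, and a
   factor [t] cancels. *)
have {}Df : fvar K t * fD c g + k.+2%:R * (c t * g) = 0.
  apply/eqP; have /eqP := Df; rewrite fE fDM fD_var.
  rewrite (_ : _ + _ = fvar K t * (fvar K t * fD c g + k.+2%:R * (c t * g))).
    by rewrite mulf_eq0 (negPf (fvar_neq0 t)).
  by rewrite -[k.+2]addn1 natrD; ring.
have mE : m = (m - U_(t) + U_(t))%MM.
  rewrite submK //; apply/mnm_lepP => i; rewrite mnm1E.
  by case: eqP => [<-|]; rewrite ?mt.
by rewrite fE mE fcoef_varM (IH _ _ Df) // mnmBE mnm1E eqxx mt subn1.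
Qed.

(** A Cauchy problem with zero data on the hyperplane where the variable [t] vanishes, the field
    being transversal to it only generically. Dividing [f] by [t] gives the Euler-type equation with
    [k = 0]. *)
Lemma flow_unique c t f : fsubst (c t) (fmask K (predC1 t)) != 0 ->
  fD c f = 0 -> fsubst f (fmask K (predC1 t)) = 0 -> f = 0.
Proof.
move=> ct Df f0; have fE := fmask0_shift f0; set g := fshift t f in fE.
suff g0 : g = 0 by rewrite fE g0 mulr0.
apply: fpsP => m; apply: (flow_coef_eq0 (k := 0) ct _ (erefl (m t))).
by move: Df; rewrite fE fDM fD_var mul1r addrC => ->.
Qed.

(* The image of [g] is the graph of the series [g t] over the variables other
   than [t], and [s] restricts to the locus where [g t] vanishes. *)
Lemma fsubst_graph_eq0 p t f (g : 'I_n -> fps p K) (s : 'I_p -> fps n K) :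
  vanish0 g -> vanish0 s -> g t != 0 -> fcomp g s =1 fmask K (predC1 t) ->
  fsubst f g = 0 -> f = 0.
Proof.
move=> vg vs gt gs fg; apply: fpsP => m; rewrite fcoef0.
move: {1}(m t) (erefl (m t)) => e; elim: e f fg m => [|e IH] f fg m mt.
all: have f0 : fsubst f (fmask K (predC1 t)) = 0.
1,3: by rewrite -(eq_fsubst f gs) -fsubstA // fg fsubst0.
  exact: (fcoef_fmask_eq0 f0).
have fE := fmask0_shift f0; set h := fshift t f in fE.
(* The factor [t] of [f] becomes the nonzero factor [g t], which cancels. *)
have hg : fsubst h g = 0.
  by apply/eqP; move/eqP: fg; rewrite fE fsubstM // fsubst_var // mulf_eq0 (negPf gt).
have mE : m = (m - U_(t) + U_(t))%MM.
  rewrite submK //; apply/mnm_lepP => i; rewrite mnm1E.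
  by case: eqP => [<-|]; rewrite -?mt.
by rewrite fE mE fcoef_varM IH // mnmBE mnm1E eqxx -mt subn1.
Qed.

End Uniqueness.

(** * Conjugation *)

Section Conjugation.
Variables (C : numClosedFieldType) (n : nat).
Implicit Types f g : fps n C.

Fact fconj_is_additive : zmod_morphism (@fconj C n).
Proof. by move=> f g; apply: fpsP => m /=; rewrite rmorphB. Qed.
HB.instance Definition _ := GRing.isZmodMorphism.Build (fps n C) (fps n C)
  (@fconj C n) fconj_is_additive.

Fact fconj_is_multiplicative : monoid_morphism (@fconj C n).
Proof.
split=> [|f g]; apply: fpsP => m; first by rewrite /= rmorph_nat.
by rewrite /= rmorph_sum; apply: eq_bigr => k _; rewrite rmorphM.
Qed.
HB.instance Definition _ := GRing.isMonoidMorphism.Build (fps n C) (fps n C)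
  (@fconj C n) fconj_is_multiplicative.

Lemma fconjK : involutive (@fconj C n).
Proof. by move=> f; apply: fpsP => m /=; rewrite conjCK. Qed.

Lemma fconj_eq0 f : (fconj f == 0) = (f == 0).
Proof. by rewrite -(inj_eq (inv_inj fconjK)) fconjK rmorph0. Qed.

Lemma fconst_fconj f : fconst (fconj f) = (fconst f)^*.
Proof. by []. Qed.

Lemma vanish0_fconj p (g : 'I_p -> fps n C) : vanish0 g ->
  vanish0 (fun i => fconj (g i)).
Proof. by move=> vg i; rewrite fconst_fconj vg conjC0. Qed.

Lemma fconj_var (i : 'I_n) : fconj (fvar C i) = fvar C i.
Proof. by apply: fpsP => m; rewrite /= rmorph_nat. Qed.

Lemma fconj_fderiv i f : fconj (fderiv i f) = fderiv i (fconj f).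
Proof. by apply: fpsP => m /=; rewrite rmorphMn. Qed.

Lemma fconj_fD c f : fconj (fD c f) = fD (fun i => fconj (c i)) (fconj f).
Proof.
rewrite rmorph_sum; apply: eq_bigr => i _.
by rewrite rmorphM /= fconj_fderiv.
Qed.

Lemma fconj_fsubst p (f : fps p C) (g : 'I_p -> fps n C) :
  fconj (fsubst f g) = fsubst (fconj f) (fun i => fconj (g i)).
Proof.
apply: fpsP => m /=; rewrite rmorph_sum; apply: eq_bigr => k _.
rewrite rmorphM; congr (_ * _); rewrite -[LHS]/(fcoef (fconj _) m).
rewrite rmorph_prod; congr fcoef.
by apply: eq_bigr => i _; rewrite rmorphXn.
Qed.

End Conjugation.


(** * The mapping equation in normal coordinates *)

Section Points.
Variable K : comNzRingType.

Lemma vcat_l T a b (u : 'I_a -> T) (v : 'I_b -> T) i : vcat u v (lshift b i) = u i.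
Proof. by rewrite /vcat -/(unsplit (inl i)) unsplitK. Qed.

Lemma vcat_r T a b (u : 'I_a -> T) (v : 'I_b -> T) i : vcat u v (rshift a i) = v i.
Proof. by rewrite /vcat -/(unsplit (inr i)) unsplitK. Qed.

Lemma vsnoc_max T a (u : 'I_a -> T) x : vsnoc u x ord_max = x.
Proof. by rewrite /vsnoc unlift_none. Qed.

Lemma vsnoc_lift T a (u : 'I_a -> T) x j : vsnoc u x (lift ord_max j) = u j.
Proof. by rewrite /vsnoc liftK. Qed.

Lemma forall_cat a b (P : 'I_(a + b) -> Prop) :
  (forall i, P (lshift b i)) -> (forall i, P (rshift a i)) -> forall i, P i.
Proof. by move=> Pl Pr i; case: (split_ordP i) => j ->. Qed.

Lemma forall_snoc a (P : 'I_a.+1 -> Prop) :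
  (forall j, P (lift ord_max j)) -> P ord_max -> forall i, P i.
Proof. by move=> Pl Pm i; case: (unliftP ord_max i) => [j|] ->. Qed.

Lemma vcat_eq T a b (u : 'I_a -> T) (v : 'I_b -> T) w :
  (forall i, w (lshift b i) = u i) -> (forall i, w (rshift a i) = v i) ->
  w = vcat u v.
Proof.
by move=> h1 h2; apply: funext; apply: forall_cat => i; rewrite ?vcat_l ?vcat_r.
Qed.

Lemma vsnoc_eq T a (u : 'I_a -> T) x w :
  (forall j, w (lift ord_max j) = u j) -> w ord_max = x -> w = vsnoc u x.
Proof.
move=> h1 h2; apply: funext; apply: forall_snoc => [j|].
  by rewrite vsnoc_lift.
by rewrite vsnoc_max.
Qed.

Lemma vsnoc0 (V : nmodType) a : vsnoc (fun _ : 'I_a => 0 : V) 0 = fun=> 0.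
Proof. by apply: esym; apply: vsnoc_eq. Qed.

Lemma fcomp_vcat n p a b (u : 'I_a -> fps p K) (v : 'I_b -> fps p K)
    (g : 'I_p -> fps n K) : fcomp (vcat u v) g = vcat (fcomp u g) (fcomp v g).
Proof. by apply: vcat_eq => i; rewrite /fcomp ?vcat_l ?vcat_r. Qed.

Lemma fcomp_vsnoc n p a (u : 'I_a -> fps p K) x (g : 'I_p -> fps n K) :
  fcomp (vsnoc u x) g = vsnoc (fcomp u g) (fsubst x g).
Proof. by apply: vsnoc_eq => *; rewrite /fcomp ?vsnoc_lift ?vsnoc_max. Qed.

Lemma fcomp0 n p a (g : 'I_p -> fps n K) :
  vanish0 g -> fcomp (fun _ : 'I_a => 0) g = fun=> 0.
Proof. by move=> vg; apply: funext => i; rewrite /fcomp fsubst0. Qed.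

Lemma fcomp_at0 n p (f : fps p K) : fconst f = 0 ->
  fsubst f (fun=> 0) = 0 :> fps n K.
Proof.
move=> f0; have e : fsubst f (fmask K pred0) = 0.
  apply: fpsP => m; rewrite fcoef_fmask; case: onlyP => // h.
  by rewrite (_ : m = 0%MM) //; apply/mnmP => i; rewrite h // mnm0E.
have -> : (fun=> 0) = fcomp (fmask K pred0) (fun _ : 'I_p => 0 : fps n K).
  by apply: funext => i; rewrite /fcomp /fmask fsubst0.
by rewrite -fsubstA // e fsubst0.
Qed.

(** Fields related by the map [g]: the relation is tested on the coordinate functions and extends to
    all series by the chain rule. *)
Lemma fD_related n p (c : 'I_n -> fps n K) (c' : 'I_p -> fps p K)
    (g : 'I_p -> fps n K) f : vanish0 g ->
  (forall i, fD c (g i) = fsubst (c' i) g) ->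
  fD c (fsubst f g) = fsubst (fD c' f) g.
Proof.
move=> vg cg; rewrite fD_fsubst // /fD fsubst_sum //; apply: eq_bigr => i _.
by rewrite -/(fD _ _) cg fsubstM // mulrC.
Qed.

Lemma fD0 n (c : 'I_n -> fps n K) : fD c 0 = 0.
Proof. exact: raddf0. Qed.

Lemma fDB n (c : 'I_n -> fps n K) f g : fD c (f - g) = fD c f - fD c g.
Proof. exact: raddfB. Qed.

Lemma fDD n (c : 'I_n -> fps n K) f g : fD c (f + g) = fD c f + fD c g.
Proof. exact: raddfD. Qed.

End Points.

#[export] Hint Resolve vanish0_vcat vanish0_vsnoc vanish0_fcomp : core.

Lemma raddf0_fconst n (K : comNzRingType) : fconst (0 : fps n K) = 0.
Proof. by []. Qed.
#[export] Hint Resolve raddf0_fconst : core.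

(** * Normality and defining series at formal points *)

Section NormalSeries.
Variables (R : realType) (n : nat).
Local Notation C := R[i].

(** The two normality identities at arbitrary formal points, so that they apply directly after any
    substitution. *)
Definition normal_Q (Q : fps (n + n.+1) C) :=
  (forall p (Y : 'I_n.+1 -> fps p C), vanish0 Y ->
     fsubst Q (vcat (fun=> 0) Y) = Y ord_max) /\
  (forall p (z : 'I_n -> fps p C) t, vanish0 z -> fconst t = 0 ->
     fsubst Q (vcat z (vsnoc (fun=> 0) t)) = t).

Lemma normal_QP (Q : fps (n + n.+1) C) :
  fsubst Q (vcat (fun=> 0) (@chitau R n)) = chitau R ord_max ->
  fsubst Q (vcat (fun j => fvar C (lift ord_max j))
                     (vsnoc (fun=> 0) (fvar C ord_max)))
        = fvar C (ord_max : 'I_n.+1) -> normal_Q Q.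
Proof.
move=> h0 h1; split=> [p Y vY|p z t vz vt].
  have := congr1 (fun f => fsubst f Y) h0.
  rewrite /= fsubstA; [|by auto..].
  rewrite fsubst_var // fcomp_vcat fcomp0 // => <-; congr (fsubst _ (vcat _ _)).
  by apply: funext => i; rewrite /fcomp fsubst_var.
have vg : vanish0 (vsnoc z t) by auto.
have := congr1 (fun f => fsubst f (vsnoc z t)) h1.
rewrite /= fsubstA; [|apply: vanish0_vcat; [by move=> ?|by auto]|by []].
rewrite fsubst_var // vsnoc_max fcomp_vcat fcomp_vsnoc fcomp0 //.
rewrite fsubst_var // vsnoc_max => e; rewrite -[RHS]e.
congr (fsubst _ (vcat _ _)); apply: funext => j.
by rewrite /fcomp fsubst_var // vsnoc_lift.
Qed.

Definition rho (Q : fps (n + n.+1) C) : fps (n.+1 + n.+1) C :=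
  @varZ R n.+1 ord_max - Qlift Q.

Definition zpart p (Z : 'I_n.+1 -> fps p C) : 'I_n -> fps p C :=
  fun j => Z (lift ord_max j).

Lemma vanish0_zpart p (Z : 'I_n.+1 -> fps p C) : vanish0 Z -> vanish0 (zpart Z).
Proof. by move=> vZ j; apply: vZ. Qed.

Lemma zpart_vsnoc p (z : 'I_n -> fps p C) w : zpart (vsnoc z w) = z.
Proof. by apply: funext => j; rewrite /zpart vsnoc_lift. Qed.

Lemma rho_pt (Q : fps (n + n.+1) C) p (Z Y : 'I_n.+1 -> fps p C) :
  vanish0 Z -> vanish0 Y ->
  fsubst (rho Q) (vcat Z Y) = Z ord_max - fsubst Q (vcat (zpart Z) Y).
Proof.
move=> vZ vY; have vg : vanish0 (vcat Z Y) by auto.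
rewrite /rho fsubstB // fsubst_var // vcat_l; congr (_ - _).
rewrite /Qlift fsubstA //; last by apply: vanish0_vcat => i; exact: fconst_var.
rewrite fcomp_vcat; congr (fsubst _ (vcat _ _)); apply: funext => i.
  by rewrite /fcomp fsubst_var // vcat_l.
by rewrite /fcomp fsubst_var // vcat_r.
Qed.

Lemma fprod_map_pt N p (h hb : 'I_N -> fps N C) (Z Y : 'I_N -> fps p C) :
  vanish0 Z -> vanish0 Y ->
  fcomp (fprod_map h hb) (vcat Z Y) = vcat (fcomp h Z) (fcomp hb Y).
Proof.
move=> vZ vY; have vg : vanish0 (vcat Z Y) by auto.
rewrite /fprod_map fcomp_vcat; congr vcat; apply: funext => i; rewrite /fcomp.
all: rewrite fsubstA //; try by move=> ?; exact: fconst_var.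
all: congr (fsubst _ _); apply: funext => j; rewrite /fcomp fsubst_var //.
  exact: vcat_l.
exact: vcat_r.
Qed.

Lemma vanish0_fprod_map N (h hb : 'I_N -> fps N C) :
  vanish0 h -> vanish0 hb -> vanish0 (fprod_map h hb).
Proof.
by move=> vh vhb; apply: vanish0_vcat; apply: vanish0_fcomp => // ?; exact: fconst_var.
Qed.

End NormalSeries.
#[export] Hint Resolve vanish0_zpart vanish0_fprod_map : core.

Section MapEquation.
Variables (R : realType) (n : nat).
Local Notation C := R[i].
Local Notation A := (fps (n.+1 + n.+1) C).
Variables (Q Q' : fps (n + n.+1) C) (h : 'I_n.+1 -> fps n.+1 C) (a : A).
Hypotheses (nQ : normal_Q Q) (nQ' : normal_Q Q') (vh : vanish0 h).
Let hb := fmap_conj h.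

Lemma vanish0_fmap_conj : vanish0 hb.
Proof. exact: vanish0_fconj. Qed.
Hint Resolve vanish0_fmap_conj : core.

Hypothesis eqn : fsubst (rho Q') (fprod_map h hb) = a * rho Q.

Lemma map_equation p (Z Y : 'I_n.+1 -> fps p C) : vanish0 Z -> vanish0 Y ->
  fsubst (h ord_max) Z - fsubst Q' (vcat (fcomp (zpart h) Z) (fcomp hb Y)) =
  fsubst a (vcat Z Y) * (Z ord_max - fsubst Q (vcat (zpart Z) Y)).
Proof.
move=> vZ vY; have vg : vanish0 (vcat Z Y) by auto.
rewrite -rho_pt // -fsubstM // -eqn fsubstA //; last by auto.
by rewrite fprod_map_pt // rho_pt //; auto.
Qed.

(** Evaluate the mapping equation at [(z, 0)] paired with the point 0: by normality [Q] and [Q']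
    both vanish there. *)
Lemma mapG_w0 p (z : 'I_n -> fps p C) : vanish0 z ->
  fsubst (h ord_max) (vsnoc z 0) = 0.
Proof.
move=> vz; have v : vanish0 (vsnoc z 0) by auto.
have := map_equation v (@vanish00 C p n.+1).
have hb0 : fcomp hb (fun=> 0 : fps p C) = fun=> 0.
  by apply: funext => i; rewrite /fcomp fcomp_at0.
rewrite hb0 -vsnoc0 !vsnoc_max zpart_vsnoc.
by rewrite !(nQ.2, nQ'.2) // ?subr0 ?mulr0 //; apply: vanish0_fcomp => //; exact: vanish0_zpart.
Qed.

Lemma mapGb_w0 p (z : 'I_n -> fps p C) : vanish0 z ->
  fsubst (hb ord_max) (vsnoc z 0) = 0.
Proof.
move=> vz; apply: (inv_inj (@fconjK _ _)).
rewrite fconj_fsubst /hb /fmap_conj fconjK rmorph0.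
have -> : (fun i => fconj (vsnoc z 0 i)) = vsnoc (fun j => fconj (z j)) 0.
  by apply: vsnoc_eq => [j|]; rewrite ?vsnoc_lift ?vsnoc_max ?rmorph0.
by apply: mapG_w0; exact: vanish0_fconj.
Qed.

End MapEquation.


(** * Maps that are totally degenerate are transversally flat *)

Section ClassC.
Variables (R : realType) (n : nat).
Local Notation C := R[i].
Local Notation B := (fps (n + n.+1) C).
Implicit Types (Q : B).

(** The class condition as a single nonzero [n] by [n] minor, with no bound on the orders of the
    multi-indices. *)
Definition full_Qrank Q := exists (s : 'I_n -> 'X_{1..n}) (t : 'I_n -> 'I_n),
  \det (\matrix_(i, j) fderiv (t j) (Qz0 Q (s i))) != 0.

Lemma generic_rank_full m (I : finType) (F : I -> fps m.+1 C) :
  generic_rank F = m.+1 -> exists (s : 'I_m.+1 -> I) (t : 'I_m.+1 -> 'I_m.+1),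
    \det (\matrix_(i < m.+1, j < m.+1) fderiv (t j) (F (s i))) != 0.
Proof.
pose P (r : 'I_m.+2) :=
  [exists s : {ffun 'I_r -> I}, exists t : {ffun 'I_r -> 'I_m.+1},
     \det (\matrix_(i < r, j < r) fderiv (t j) (F (s i))) != 0].
rewrite /generic_rank -/(\max_(r < m.+2 | P r) r) => maxP.
have [/existsP[s /existsP[t st]]|nP] := boolP (P ord_max); first by exists s, t.
suff : (\max_(r < m.+2 | P r) r <= m)%N by rewrite maxP ltnn.
apply/bigmax_leqP => r Pr; rewrite -ltnS ltn_neqAle -ltnS ltn_ord andbT.
by apply: contraNneq nP => rm; rewrite (_ : ord_max = r) //; apply: val_inj.
Qed.

(** Stated for a general operator because it serves for vector fields in chi, for the restriction to
    [tau = 0] and for the zero map. *)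
Lemma fderiv_z_comm (T : B -> B) :
  (forall j f, T (fderiv (lshift n.+1 j) f) = fderiv (lshift n.+1 j) (T f)) ->
  forall alpha Q, T (fderiv_z alpha Q) = fderiv_z alpha (T Q).
Proof.
move=> TD alpha Q; rewrite /fderiv_z; elim: (enum _) => //= i s IH.
by elim: (alpha i) => [|k IHk] //=; rewrite TD IHk.
Qed.

Lemma fderiv_z0 alpha : fderiv_z alpha (0 : B) = 0.
Proof.
apply: esym; apply: (@fderiv_z_comm (fun=> 0) _ alpha 0) => j f.
by rewrite fderiv0.
Qed.

Definition chiB (i : 'I_n) : B := fvar C (rshift n (lift ord_max i)).

Lemma vanish0_chiB : vanish0 chiB. Proof. by move=> i; exact: fconst_var. Qed.
Hint Resolve vanish0_chiB : core.

(* The vector field sum_i X_i(chi) d/dchi_i in the variables (z, chi, tau). *)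
Definition fieldB (X : 'I_n -> fps n C) : 'I_(n + n.+1) -> B :=
  vcat (fun=> 0) (vsnoc (fcomp X chiB) 0).

(** A repeated column would make the determinant zero, so [t] is a permutation; multiplying by the
    adjugate then gives [\det P * v j = 0]. *)
Lemma det_col_eq0 k (K : idomainType) (t : 'I_k -> 'I_k) (M : 'M[K]_k) (v : 'I_k -> K) :
  \det (\matrix_(i, j) M i (t j)) != 0 -> (forall i, \sum_j M i j * v j = 0) ->
  forall j, v j = 0.
Proof.
set P := \matrix_(i, j) _ => dP Mv.
have tI : injective t.
  move=> j1 j2 tj; apply/eqP; apply: contraNT dP => j12; rewrite -det_tr.
  apply/eqP; apply: (determinant_alternate j12) => i.
  by rewrite !mxE tj.
have Pv : P *m (\col_j v (t j)) = 0.
  apply/colP => i; rewrite !mxE -[RHS](Mv i).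
  rewrite [RHS](reindex_onto t (invF tI)) => [|j _]; last by rewrite f_invF.
  by apply: eq_big => [j|j _]; rewrite ?invF_f ?eqxx // !mxE.
move=> j; have := congr1 (mulmx (\adj P)) Pv; rewrite mulmxA mul_adj_mx mulmx0.
move=> /colP /(_ (invF tI j)); rewrite mul_scalar_mx !mxE f_invF => /eqP.
by rewrite mulf_eq0 (negPf dP) => /eqP.
Qed.

(** If [X Q] vanished for [tau = 0], differentiating in z and setting [z = 0] would show that [X]
    kills every [Qz0 Q alpha], against the nonzero minor. The map [s] carries an identity at the
    points [(z, chi, 0)] back to the variables of [Q]. *)
Lemma fieldB_Q_neq0 Q X p (z chi : 'I_n -> fps p C) (s : 'I_p -> B) :
  full_Qrank Q -> (exists i, X i != 0) -> vanish0 z -> vanish0 chi -> vanish0 s ->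
  fcomp z s =1 (fun j => fvar C (lshift n.+1 j)) -> fcomp chi s =1 chiB ->
  fsubst (fD (fieldB X) Q) (vcat z (vsnoc chi 0)) != 0.
Proof.
move=> [t0 [t dQ]] [k Xk] vz vchi vs zs chis; apply/eqP => S0.
have vp : vanish0 (vcat z (vsnoc chi 0)) by auto.
pose sg : 'I_(n + n.+1) -> B := vcat (fun j => fvar C (lshift n.+1 j)) (vsnoc chiB 0).
have vsg : vanish0 sg.
  by apply: vanish0_vcat => [?|]; [exact: fconst_var|auto].
have Ssg : fsubst (fD (fieldB X) Q) sg = 0.
  have <- : fcomp (vcat z (vsnoc chi 0)) s = sg.
    rewrite fcomp_vcat fcomp_vsnoc fsubst0 //.
    by rewrite (funext zs) (funext chis).
  by rewrite -fsubstA // S0 fsubst0.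
pose ka : 'I_(n + n.+1) -> fps n C := vcat (fun=> 0) (vsnoc (@fvar C n) 0).
have vka : vanish0 ka by apply: vanish0_vcat => //; apply: vanish0_vsnoc.
have sgka : fcomp sg ka = ka.
  rewrite fcomp_vcat fcomp_vsnoc fsubst0 //; apply/esym/vcat_eq => i.
    by rewrite /fcomp fsubst_var.
  rewrite /ka vcat_r; congr (vsnoc _ _ _); apply: funext => j.
  by rewrite /fcomp fsubst_var // /ka vcat_r vsnoc_lift.
have QX alpha : fD X (Qz0 Q alpha) = 0.
  rewrite /Qz0 -/ka (@fD_related _ _ _ _ (fieldB X)) //; last first.
    apply: forall_cat => i; rewrite /fieldB /ka ?vcat_l ?vcat_r ?fD0 ?fsubst0 //.
    move: i; apply: forall_snoc => [j|]; last by rewrite !vsnoc_max fD0 fsubst0.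
    rewrite !vsnoc_lift fD_var /fcomp fsubstA //.
    rewrite (_ : fcomp chiB _ = @fvar C n) ?fsubst_id //.
    by apply: funext => i; rewrite /fcomp fsubst_var // vcat_r vsnoc_lift.
  (* Restrict first to [tau = 0] by [sg], then to [z = 0] by [ka]. The coefficients of [fieldB X]
     depend on chi only, so it commutes with the z-derivatives, as does the restriction by [sg]. *)
  rewrite -sgka -fsubstA // fderiv_z_comm; last first.
    move=> j f; rewrite /fD raddf_sum; apply: eq_bigr => i _ /=.
    rewrite fderivM fderiv_comm (_ : fderiv _ (fieldB X i) = 0) ?mul0r ?add0r //.
    move: i; apply: forall_cat => i; rewrite /fieldB ?vcat_l ?vcat_r ?fderiv0 //.
    move: i; apply: forall_snoc => [i|]; last by rewrite vsnoc_max fderiv0.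
    rewrite vsnoc_lift /fcomp fderiv_fsubst // big1 // => l _.
    by rewrite /chiB fderiv_var -val_eqE /= ltn_eqF ?mulr0 // ltn_addr.
  rewrite (fderiv_z_comm (T := fun f => fsubst f sg)) ?Ssg ?fderiv_z0 ?fsubst0 //.
  move=> j f; rewrite fderiv_fsubst // (bigD1 (lshift n.+1 j)) //=.
  rewrite big1 => [|i].
    by rewrite addr0 /sg vcat_l fderiv_var eqxx mulr1.
  move: i; apply: forall_cat => i ij; rewrite /sg ?vcat_l ?vcat_r.
    by rewrite fderiv_var eq_sym (negPf ij) mulr0.
  move: i {ij}; apply: forall_snoc => [i|]; last by rewrite vsnoc_max fderiv0 mulr0.
  by rewrite vsnoc_lift /chiB fderiv_var -val_eqE /= ltn_eqF ?mulr0 // ltn_addr.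
case/eqP: Xk; apply: (@det_col_eq0 _ _ t (\matrix_(i, j) fderiv j (Qz0 Q (t0 i)))).
  apply: contraNneq dQ => d0; apply/eqP; rewrite -d0; congr determinant.
  by apply/matrixP => i j; rewrite !mxE.
by move=> i; rewrite -[RHS](QX (t0 i)) /fD; apply: eq_bigr => j _; rewrite mxE mulrC.
Qed.

End ClassC.


(** * The coordinates (z, w, chi, tau) *)

Section Coordinates.
Variables (R : realType) (n : nat).
Local Notation C := R[i].
Local Notation A := (fps (n.+1 + n.+1) C).

Definition zA (j : 'I_n) : A := fvar C (lshift n.+1 (lift ord_max j)).
Definition wA : A := fvar C (lshift n.+1 ord_max).
Definition chiA (j : 'I_n) : A := fvar C (rshift n.+1 (lift ord_max j)).
Definition tauA : A := fvar C (rshift n.+1 ord_max).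

Lemma vanish0_zA : vanish0 zA. Proof. by move=> i; exact: fconst_var. Qed.
Lemma vanish0_chiA : vanish0 chiA. Proof. by move=> i; exact: fconst_var. Qed.
Lemma fconst_wA : fconst wA = 0. Proof. exact: fconst_var. Qed.
Lemma fconst_tauA : fconst tauA = 0. Proof. exact: fconst_var. Qed.

Definition pt T (z : 'I_n -> T) w chi tau : 'I_(n.+1 + n.+1) -> T :=
  vcat (vsnoc z w) (vsnoc chi tau).

Lemma vanish0_pt p (z : 'I_n -> fps p C) w chi tau : vanish0 z -> fconst w = 0 ->
  vanish0 chi -> fconst tau = 0 -> vanish0 (pt z w chi tau).
Proof. by move=> *; apply: vanish0_vcat; apply: vanish0_vsnoc. Qed.

Lemma fcomp_pt p q (z : 'I_n -> fps p C) w chi tau (g : 'I_p -> fps q C) :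
  fcomp (pt z w chi tau) g =
  pt (fcomp z g) (fsubst w g) (fcomp chi g) (fsubst tau g).
Proof. by rewrite /pt fcomp_vcat !fcomp_vsnoc. Qed.

Lemma forall_pt (P : 'I_(n.+1 + n.+1) -> Prop) :
  (forall j, P (lshift n.+1 (lift ord_max j))) -> P (lshift n.+1 ord_max) ->
  (forall j, P (rshift n.+1 (lift ord_max j))) -> P (rshift n.+1 ord_max) ->
  forall i, P i.
Proof.
move=> h1 h2 h3 h4; apply: forall_cat; exact: forall_snoc.
Qed.

Section PtE.
Variables (T : Type) (z : 'I_n -> T) (w : T) (chi : 'I_n -> T) (tau : T).
Let q := pt z w chi tau.
Lemma ptEz j : q (lshift n.+1 (lift ord_max j)) = z j.
Proof. by rewrite /q /pt vcat_l vsnoc_lift. Qed.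
Lemma ptEw : q (lshift n.+1 ord_max) = w.
Proof. by rewrite /q /pt vcat_l vsnoc_max. Qed.
Lemma ptEchi j : q (rshift n.+1 (lift ord_max j)) = chi j.
Proof. by rewrite /q /pt vcat_r vsnoc_lift. Qed.
Lemma ptEtau : q (rshift n.+1 ord_max) = tau.
Proof. by rewrite /q /pt vcat_r vsnoc_max. Qed.
Definition ptE := (ptEz, ptEw, ptEchi, ptEtau).
End PtE.

Section SubstPt.
Variables (p : nat) (z : 'I_n -> fps p C) (w : fps p C).
Variables (chi : 'I_n -> fps p C) (tau : fps p C).
Hypothesis v : vanish0 (pt z w chi tau).

Lemma fcomp_zA : fcomp zA (pt z w chi tau) = z.
Proof. by apply: funext => j; rewrite /fcomp fsubst_var // ptE. Qed.
Lemma fsubst_wA : fsubst wA (pt z w chi tau) = w.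
Proof. by rewrite fsubst_var // ptE. Qed.
Lemma fcomp_chiA : fcomp chiA (pt z w chi tau) = chi.
Proof. by apply: funext => j; rewrite /fcomp fsubst_var // ptE. Qed.

End SubstPt.

Lemma fsubst_conj0 p (f : fps n.+1 C) (z : 'I_n -> fps p C) :
  fsubst (fconj f) (vsnoc z 0) =
  fconj (fsubst f (vsnoc (fun j => fconj (z j)) 0)).
Proof.
rewrite fconj_fsubst; congr fsubst; apply/esym/vsnoc_eq => [j|].
  by rewrite vsnoc_lift fconjK.
by rewrite vsnoc_max rmorph0.
Qed.

End Coordinates.
#[export] Hint Resolve vanish0_zA vanish0_chiA fconst_wA fconst_tauA vanish0_pt : core.

(** * The case where det F_z(z, 0) is zero *)

Section Degenerate.
Variables (R : realType) (n : nat).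
Local Notation C := R[i].
Local Notation A := (fps (n.+1 + n.+1) C).
Local Notation zA := (@zA R n).
Local Notation wA := (wA R n).
Local Notation chiA := (@chiA R n).
Variables (Q Q' : fps (n + n.+1) C) (h : 'I_n.+1 -> fps n.+1 C) (a : A).
Hypotheses (nQ : normal_Q Q) (nQ' : normal_Q Q') (vh : vanish0 h).
Hypothesis eqn : fsubst (rho Q') (fprod_map h (fmap_conj h)) = a * rho Q.
Hypothesis rankQ : full_Qrank Q.

(** The series R(z, chi): the points [(z, RA, chi, 0)] parametrize the part of M where [tau = 0]. *)
Definition RA : A := fsubst Q (vcat zA (vsnoc chiA 0)).

Lemma vanish0_zchi0 : vanish0 (vcat zA (vsnoc chiA 0)).
Proof. by apply: vanish0_vcat => //; apply: vanish0_vsnoc. Qed.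
Hint Resolve vanish0_zchi0 : core.

Lemma fconst_RA : fconst RA = 0.
Proof.
rewrite fconst_fsubst //; have := nQ.1 _ (fun=> 0) (@vanish00 C n n.+1).
move=> /(congr1 (@fconst C n)); rewrite fconst_fsubst //.
exact: vanish0_vcat.
Qed.
Hint Resolve fconst_RA : core.

Lemma fsubst_RA p z w chi tau : vanish0 (pt z w chi tau) ->
  fsubst RA (pt z w chi tau) = fsubst Q (vcat z (vsnoc chi 0)) :> fps p C.
Proof.
move=> v; rewrite fsubstA // fcomp_vcat fcomp_vsnoc fsubst0 //.
by rewrite fcomp_zA // fcomp_chiA.
Qed.

Lemma fieldB_RA_neq0 X : (exists i, X i != 0) ->
  fsubst (fD (fieldB X) Q) (vcat zA (vsnoc chiA 0)) != 0.
Proof.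
move=> X0.
pose s : 'I_(n.+1 + n.+1) -> fps (n + n.+1) C :=
  pt (fun j => fvar C (lshift n.+1 j)) 0 (@chiB R n) 0.
have vs : vanish0 s by apply: vanish0_pt => // ?; exact: fconst_var.
apply: (fieldB_Q_neq0 (s := s)) => // j.
  by rewrite fcomp_zA.
by rewrite fcomp_chiA.
Qed.

(** [RA] involves neither w nor tau, so these components of [c] are left free. *)
Lemma fD_RA X c : (forall j, c (lshift n.+1 (lift ord_max j)) = 0) ->
  (forall j, c (rshift n.+1 (lift ord_max j)) = fsubst (X j) chiA) ->
  fD c RA = fsubst (fD (fieldB X) Q) (vcat zA (vsnoc chiA 0)).
Proof.
move=> cz cchi; rewrite /RA (@fD_related _ _ _ _ (fieldB X)) //.
apply: forall_cat => i; rewrite /fieldB ?vcat_l ?vcat_r.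
  by rewrite fsubst0 // fD_var cz.
move: i; apply: forall_snoc => [j|]; last by rewrite !vsnoc_max fsubst0 // fD0.
rewrite !vsnoc_lift fD_var cchi /fcomp fsubstA //; last exact: vanish0_chiB.
congr fsubst; apply: funext => i.
by rewrite /fcomp fsubst_var // vcat_r vsnoc_lift.
Qed.

(** The constant field with all components 1 is nonzero as [n > 0], hence does not kill [RA]. *)
Lemma RA_neq0 : (0 < n)%N -> RA != 0.
Proof.
move=> n0; pose X : 'I_n -> fps n C := fun=> 1.
have X0 : exists i, X i != 0 by exists (Ordinal n0); exact: oner_neq0.
apply: contra_neq (fieldB_RA_neq0 X0) => RA0.
rewrite -(@fD_RA X (pt (fun=> 0) 0 (fun=> 1) 0)) ?RA0 ?fD0 // => j.
  by rewrite ptE.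
by rewrite ptE fsubst1.
Qed.

Lemma degenerate_mapG0 : \det (Fz0 h) = 0 -> h ord_max = 0.
Proof.
(* A nonzero vector [v] of series with F_z(z, 0) v = 0; its conjugate [X] annihilates Fbar(chi,
   0). *)
rewrite -det_tr => /eqP /det0P [v v0 vF].
pose X j := fconj (v 0 j).
have X0 : exists i, X i != 0.
  by case/rV0Pn: v0 => i vi; exists i; rewrite fconj_eq0.
set XR := fsubst (fD (fieldB X) Q) (vcat zA (vsnoc chiA 0)).
(* The w-component is chosen so that [c] kills [wA + RA]. *)
pose c : 'I_(n.+1 + n.+1) -> A := pt (fun=> 0) (- XR) (fcomp X chiA) 0.
have cRA : fD c RA = XR.
  by apply: fD_RA => j; rewrite /c ptE.
pose Z := vsnoc zA (wA + RA); pose Y := vsnoc chiA (0 : A).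
have vZ : vanish0 Z.
  apply: vanish0_vsnoc => //; rewrite -[LHS]/(fconst wA + fconst RA).
  by rewrite fconst_RA addr0 fconst_wA.
have vY : vanish0 Y by apply: vanish0_vsnoc.
pose hb := fmap_conj h.
have vhb : vanish0 hb by exact: vanish0_fmap_conj.
have DZ i : fD c (Z i) = 0.
  move: i; apply: forall_snoc => [j|]; rewrite /Z ?vsnoc_lift ?vsnoc_max.
    by rewrite fD_var /c ptE.
  by rewrite fDD fD_var cRA /c ptE addNr.
have vn : vanish0 (vsnoc (@fvar C n) 0) by apply: vanish0_vsnoc.
have DhY i : fD c (fsubst (hb i) Y) = 0.
  move: i; apply: forall_snoc => [i|]; last first.
    by rewrite /Y (mapGb_w0 nQ nQ' vh eqn) ?fD0.
  have -> : fsubst (hb (lift ord_max i)) Y =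
            fsubst (fsubst (hb (lift ord_max i)) (vsnoc (@fvar C n) 0)) chiA.
    rewrite fsubstA // fcomp_vsnoc fsubst0 //; congr (fsubst _ (vsnoc _ _)).
    by apply: funext => j; rewrite /fcomp fsubst_var.
  rewrite (fD_related (c' := X) _ (@vanish0_chiA R n)) => [|j]; last first.
    by rewrite fD_var /c ptE.
  rewrite fD_fsubst // (bigD1_ord ord_max) //= vsnoc_max fD0 mulr0 add0r.
  rewrite (_ : \sum_(_ < _) _ = fconj ((v *m (Fz0 h)^T) 0 i)).
    by rewrite vF mxE rmorph0 fsubst0 //; exact: vanish0_chiA.
  rewrite mxE rmorph_sum; apply: eq_bigr => j _; rewrite !mxE vsnoc_lift fD_var.
  rewrite rmorphM mulrC; congr (_ * _); rewrite /hb /fmap_conj -fconj_fderiv.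
  rewrite fsubst_conj0 /mapF; congr (fconj (fsubst _ (vsnoc _ _))).
  by apply: funext => k; rewrite fconj_var.
(* At this point the defining series of M takes the value w, so [E] is a multiple of w. *)
have := map_equation vh eqn vZ vY.
set E := (X in X = _); rewrite {2}/Z vsnoc_max zpart_vsnoc -/RA addrK => EE.
have DE : fD c E = 0.
  rewrite /E fDB !fD_fsubst0 ?subr0 //.
    apply: vanish0_vcat; apply: vanish0_fcomp => //; exact: vanish0_zpart.
  apply: forall_cat => i; rewrite ?vcat_l ?vcat_r ?DhY //.
  by rewrite /fcomp fD_fsubst0.
have E0 : E = 0.
  (* The w-component [- XR] does not involve w and is nonzero by the class condition. *)
  apply: (flow_unique (t := lshift n.+1 ord_max) _ DE); last first.
    rewrite EE fsubstM // /wA [X in _ * X]fsubst_var // /fmask /= eqxx mulr0 //.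
  have maskE : fmask C (predC1 (lshift n.+1 ord_max)) = pt zA 0 chiA (tauA R n).
    apply: funext; apply: forall_pt => [j||j|]; rewrite ptE /fmask /=.
    - by rewrite (inj_eq (@lshift_inj _ _)) eq_sym (negPf (neq_lift _ _)).
    - by rewrite eqxx.
    - by rewrite eq_rlshift.
    - by rewrite eq_rlshift.
  have := fieldB_RA_neq0 X0; rewrite -/XR; apply: contra_neq.
  rewrite /c ptE fsubstN // => /eqP; rewrite oppr_eq0 => /eqP.
  have vm : vanish0 (pt zA 0 chiA (tauA R n)) by exact: vanish0_pt.
  rewrite maskE /XR (fsubstA _ vanish0_zchi0 vm) fcomp_vcat fcomp_vsnoc.
  rewrite fsubst0 ?fcomp_zA ?fcomp_chiA //; exact: vanish0_pt.
(* At [chi = tau = 0] both [RA] and the [Q'] term vanish, so [E] becomes G(z, w). *)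
pose s := pt (zpart (@fvar C n.+1)) (fvar C ord_max) (fun=> 0) 0.
have vs : vanish0 s by apply: vanish0_pt => //; exact: vanish0_zpart.
have := congr1 (fun f => fsubst f s) E0; rewrite fsubst0 //.
have RAs : fsubst RA s = 0.
  by rewrite fsubst_RA // (nQ.2) //; exact: vanish0_zpart.
have Zs : fcomp Z s = @fvar C n.+1.
  rewrite fcomp_vsnoc fsubstD // RAs addr0 fsubst_wA // fcomp_zA //.
  exact/esym/vsnoc_eq.
have Ys : fcomp Y s = fun=> 0.
  by rewrite fcomp_vsnoc fcomp_chiA // fsubst0 // vsnoc0.
rewrite /E fsubstB // !fsubstA //; last first.
  apply: vanish0_vcat; apply: vanish0_fcomp => //; exact: vanish0_zpart.
rewrite fcomp_vcat Zs fsubst_id => <-.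
have -> : fcomp (fcomp hb Y) s = vsnoc (fun=> 0) 0.
  rewrite vsnoc0; apply: funext => i; rewrite /fcomp fsubstA // Ys.
  exact: fcomp_at0.
rewrite (nQ'.2) ?subr0 //.
do 2! [apply: vanish0_fcomp => //]; exact: vanish0_zpart.
Qed.

End Degenerate.


(** * Nondegenerate maps and transversality *)

Section ChiWeight.
Variables (n : nat).

Definition chi_weight (m : 'X_{1..n.+1 + n.+1}) : nat :=
  \sum_(j < n) m (rshift n.+1 (lift ord_max j)).

Lemma chi_weightD k l : chi_weight (k + l)%MM = (chi_weight k + chi_weight l)%N.
Proof. by rewrite /chi_weight -big_split; apply: eq_bigr => j _; rewrite mnmDE. Qed.

Definition chi_var : pred 'I_(n.+1 + n.+1) :=
  fun i => [exists j : 'I_n, i == rshift n.+1 (lift ord_max j)].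

Definition z_var : pred 'I_(n.+1 + n.+1) :=
  fun i => [exists j : 'I_n, i == lshift n.+1 (lift ord_max j)].

Lemma chi_weight_z m : only z_var m -> chi_weight m = 0%N.
Proof.
move=> /onlyP mz; rewrite /chi_weight big1 // => j _; apply: mz.
by apply/existsP => -[k]; rewrite eq_rlshift.
Qed.

Lemma chi_weight_gt0 m : only chi_var m -> m != 0%MM -> (0 < chi_weight m)%N.
Proof.
move=> /onlyP mchi; rewrite lt0n; apply: contraNneq => /eqP.
rewrite sum_nat_eq0 => /forallP mj; apply/eqP/mnmP => i; rewrite mnm0E.
have [/existsP[j /eqP ->]|/mchi //] := boolP (chi_var i).
by apply/eqP; apply: mj.
Qed.

End ChiWeight.

Lemma mulmx_adj_col (K : comNzRingType) n (M : 'M[K]_n) (v : 'cV_n) i :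
  \sum_j M i j * (\adj M *m v) j 0 = \det M * v i 0.
Proof.
have E : M *m (\adj M *m v) = \det M *: v.
  by rewrite mulmxA (mul_mx_adj M) mul_scalar_mx.
by have := congr1 (fun N : 'cV_n => N i 0) E; rewrite !mxE.
Qed.

Lemma fcompA (K : comNzRingType) n p q r (F : 'I_r -> fps q K)
    (G : 'I_q -> fps p K) (H : 'I_p -> fps n K) : vanish0 G -> vanish0 H ->
  fcomp (fcomp F G) H = fcomp F (fcomp G H).
Proof. by move=> vG vH; apply: funext => i; rewrite /fcomp fsubstA. Qed.

(** * The case where det F_z(z, 0) is nonzero *)

Section Nondegenerate.
Variables (R : realType) (n : nat).
Local Notation C := R[i].
Local Notation A := (fps (n.+1 + n.+1) C).
Local Notation zA := (@zA R n).
Local Notation wA := (wA R n).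
Local Notation chiA := (@chiA R n).
Local Notation tauA := (tauA R n).

Lemma mask_chi : fmask C (@chi_var n) = pt (fun=> 0) 0 chiA 0.
Proof.
apply: funext; apply: forall_pt => [j||j|]; rewrite ptE /fmask; case: ifPn => //.
- by case/existsP=> k; rewrite eq_lrshift.
- by case/existsP=> k; rewrite eq_lrshift.
- by move=> /negP[]; apply/existsP; exists j.
- case/existsP=> k.
  by rewrite (inj_eq (@rshift_inj _ _)) (negPf (neq_lift _ _)).
Qed.

Lemma mask_z : fmask C (@z_var n) = pt zA 0 (fun=> 0) 0.
Proof.
apply: funext; apply: forall_pt => [j||j|]; rewrite ptE /fmask; case: ifPn => //.
- by move=> /negP[]; apply/existsP; exists j.
- case/existsP=> k.
  by rewrite (inj_eq (@lshift_inj _ _)) (negPf (neq_lift _ _)).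
- by case/existsP=> k; rewrite eq_rlshift.
- by case/existsP=> k; rewrite eq_rlshift.
Qed.

(* If b(0) = 0, then the chi-order of the left-hand side exceeds that of d,
   while b has chi-order 0 and the chi-order of k is at most that of d. *)
Lemma chi_order_const_neq0 (u b k d : A) :
  u * (fsubst b (fmask C (@chi_var n)) * d) = b * k ->
  fsubst k (fmask C (@chi_var n)) = d -> d != 0 ->
  fsubst b (fmask C (@z_var n)) != 0 -> fconst b != 0.
Proof.
move=> ubd kd /fps_neq0[m0 dm0] /fps_neq0[mz bmz]; apply/eqP => b0.
have [m1 [dm1 minm1]] := low_term_exists (@chi_weight n) dm0.
have bz : exists2 m, fcoef b m != 0 & (chi_weight m <= 0)%N.
  move: bmz; rewrite fcoef_fmask; case: ifP => [oz bm|_]; last by rewrite eqxx.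
  by exists mz; rewrite // chi_weight_z.
have kz : exists2 m, fcoef k m != 0 & (chi_weight m <= chi_weight m1)%N.
  move: dm1; rewrite -kd fcoef_fmask; case: ifP => [_ km|_]; last by rewrite eqxx.
  by exists m1.
have [m bkm wm] := fcoefM_low_weight (@chi_weightD n) bz kz.
move: bkm; rewrite -ubd => /fcoefM_supp[l [l' [ml _]]].
move=> /fcoefM_supp[l1 [l2 [ll bl1 dl2]]].
have w2 : (chi_weight m1 <= chi_weight l2)%N.
  by case: (minm1 _ dl2) => [/ltnW|[->]].
have w1 : (0 < chi_weight l1)%N.
  move: bl1; rewrite fcoef_fmask; case: ifP => [oc bl|_]; last by rewrite eqxx.
  by apply: chi_weight_gt0 => //; apply: contraNneq bl => ->; apply/eqP.
by move: wm; rewrite ml ll !chi_weightD; lia.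
Qed.

Variables (Q Q' : fps (n + n.+1) C) (h : 'I_n.+1 -> fps n.+1 C) (a : A).
Hypotheses (nQ : normal_Q Q) (nQ' : normal_Q Q') (vh : vanish0 h).
Hypothesis eqn : fsubst (rho Q') (fprod_map h (fmap_conj h)) = a * rho Q.
Hypothesis Q_neq0 : RA Q != 0.
Hypothesis G_neq0 : h ord_max != 0.
Hypothesis F_nondeg : \det (Fz0 h) != 0.

Let hb := fmap_conj h.
Let Jac := \matrix_(i < n, j < n) fderiv (lift ord_max j) (h (lift ord_max i)).
Let Fw := \col_(i < n) fderiv ord_max (h (lift ord_max i)).

(* The vector field tangent to the fibres of F. *)
Let c0 : 'I_n.+1 -> fps n.+1 C :=
  vsnoc (fun j => - (\adj Jac *m Fw) j 0) (\det Jac).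
Let J := fD c0 (h ord_max).
Let z0 : 'I_n.+1 -> fps n C := vsnoc (@fvar C n) 0.
Let d0 := \det (Fz0 h).

Let vz0 : vanish0 z0. Proof. exact: vanish0_vsnoc. Qed.
Let vhb : vanish0 hb. Proof. exact: vanish0_fmap_conj. Qed.

(** By F_z adj(F_z) = det(F_z), the z-part contributes - det(F_z) F_w, which cancels the w-part. *)
Lemma fibre_field_F i : fD c0 (h (lift ord_max i)) = 0.
Proof.
rewrite /fD (bigD1_ord ord_max) //= /c0 vsnoc_max.
under eq_bigr do rewrite vsnoc_lift mulNr.
rewrite sumrN; apply/eqP; rewrite subr_eq0; apply/eqP.
have := mulmx_adj_col Jac Fw i; rewrite [Fw i 0]mxE => <-.
by apply: eq_bigr => j _; rewrite [Jac i j]mxE mulrC.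
Qed.

Lemma det_Jac_z0 : fsubst (\det Jac) z0 = d0.
Proof.
rewrite (fsubst_det vz0) /d0; congr (\det _).
by apply/matrixP => i j; rewrite !mxE.
Qed.

(** Otherwise G is killed by [c0] and vanishes at [w = 0], where the w-component of [c0] restricts
    to [d0], which is nonzero; uniqueness would give [G = 0]. *)
Lemma J_neq0 : J != 0.
Proof.
apply: contraNneq G_neq0 => J0.
have maskE : fmask C (predC1 (ord_max : 'I_n.+1)) = vsnoc (zpart (@fvar C n.+1)) 0.
  apply: vsnoc_eq => [j|]; rewrite /fmask /= ?eqxx //.
  by rewrite eq_sym (negPf (neq_lift _ _)).
apply/eqP/(flow_unique (c := c0) (t := ord_max)) => //; last first.
  rewrite maskE (mapG_w0 nQ nQ' vh eqn) //; exact: vanish0_zpart.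
apply: contraNneq F_nondeg => dm; rewrite -/d0 -det_Jac_z0.
have -> : z0 = fcomp (fmask C (predC1 (ord_max : 'I_n.+1))) z0.
  rewrite maskE fcomp_vsnoc fsubst0 //; congr vsnoc; apply: funext => j.
  by rewrite /fcomp /zpart fsubst_var // /z0 vsnoc_lift.
by move: dm; rewrite /c0 vsnoc_max -fsubstA // => ->; rewrite fsubst0.
Qed.

(** [s0] parametrizes M over [tau = 0]; below, [c1] is the field [c0] acting on Z and [c2] its
    conjugate acting on zeta, while [e1] and [e2] restrict to the z-axis and the chi-axis. *)
Let s0 := pt zA (RA Q) chiA 0.
Let b := fsubst a s0.
Let Zv := @varZ R n.+1.
Let Yv := @varzeta R n.+1.
Let cb i := fconj (c0 i).
Let Jb := fD cb (hb ord_max).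
Let c1 : 'I_(n.+1 + n.+1) -> A := vcat (fcomp c0 Zv) (fun=> 0).
Let c2 : 'I_(n.+1 + n.+1) -> A := vcat (fun=> 0) (fcomp cb Yv).

Let vZv : vanish0 Zv. Proof. by move=> i; exact: fconst_var. Qed.
Let vYv : vanish0 Yv. Proof. by move=> i; exact: fconst_var. Qed.
Let vRA : fconst (RA Q) = 0. Proof. exact: fconst_RA. Qed.
Let vs0 : vanish0 s0. Proof. exact: vanish0_pt. Qed.
Let e1 : 'I_(n.+1 + n.+1) -> fps n C := pt (@fvar C n) 0 (fun=> 0) 0.
Let e2 : 'I_(n.+1 + n.+1) -> fps n C := pt (fun=> 0) 0 (@fvar C n) 0.
Let g1 : 'I_(n.+1 + n.+1) -> fps n.+1 C := vcat (@fvar C n.+1) (fun=> 0).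
Let g2 : 'I_(n.+1 + n.+1) -> fps n.+1 C := vcat (fun=> 0) (@fvar C n.+1).
Let ve1 : vanish0 e1. Proof. exact: vanish0_pt. Qed.
Let ve2 : vanish0 e2. Proof. exact: vanish0_pt. Qed.
Let vg1 : vanish0 g1. Proof. exact: vanish0_vcat. Qed.
Let vg2 : vanish0 g2. Proof. exact: vanish0_vcat. Qed.

Let comp_Zv p (Z Y : 'I_n.+1 -> fps p C) : vanish0 (vcat Z Y) ->
  fcomp Zv (vcat Z Y) = Z.
Proof. by move=> v; apply: funext => i; rewrite /fcomp fsubst_var // vcat_l. Qed.
Let comp_Yv p (Z Y : 'I_n.+1 -> fps p C) : vanish0 (vcat Z Y) ->
  fcomp Yv (vcat Z Y) = Y.
Proof. by move=> v; apply: funext => i; rewrite /fcomp fsubst_var // vcat_r. Qed.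

(** Normality gives R(z, 0) = 0, and R(0, chi) = 0 for the companion [s0_e2]. *)
Lemma s0_e1 : fcomp s0 e1 = fcomp g1 z0.
Proof.
rewrite /s0 fcomp_pt fcomp_zA // fcomp_chiA // fsubst0 // fsubst_RA //.
rewrite (nQ.2) // /g1 fcomp_vcat fcomp0 // /pt vsnoc0; congr vcat.
by apply: funext => i; rewrite /fcomp fsubst_var.
Qed.

Lemma s0_e2 : fcomp s0 e2 = fcomp g2 z0.
Proof.
rewrite /s0 fcomp_pt fcomp_zA // fcomp_chiA // fsubst0 // fsubst_RA //.
rewrite (nQ.1) // vsnoc_max /g2 fcomp_vcat fcomp0 // /pt vsnoc0; congr vcat.
by apply: funext => i; rewrite /fcomp fsubst_var.
Qed.

Let W := vcat (fcomp (zpart h) Zv) (fcomp hb Yv).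
Let vW : vanish0 W.
Proof. by apply: vanish0_vcat; apply: vanish0_fcomp => //; exact: vanish0_zpart. Qed.

Lemma relation_eval : fsubst (h ord_max) Zv - fsubst Q' W = a * rho Q.
Proof.
rewrite -eqn /fprod_map rho_pt //; first exact: vanish0_fcomp.
by apply: vanish0_fcomp => //; exact: vanish0_fmap_conj.
Qed.

Lemma rho_s0 : fsubst (rho Q) s0 = 0.
Proof.
rewrite rho_pt; [|exact: vanish0_vsnoc..].
by rewrite vsnoc_max zpart_vsnoc subrr.
Qed.

(** Apply [c1] to the mapping equation and restrict to M. The field kills every argument of [Q'],
    leaving J on the left; on the right the Leibniz term containing [rho Q] vanishes on M. *)
Lemma J_on_M : fsubst J (vsnoc zA (RA Q)) = b * fsubst (fD c1 (rho Q)) s0.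
Proof.
have rel k : fD c1 (fsubst (h k) Zv) = fsubst (fD c0 (h k)) Zv.
  by apply: fD_related => // i; rewrite fD_var /c1 vcat_l.
have := congr1 (fun f => fsubst (fD c1 f) s0) relation_eval.
rewrite /= fDB rel fD_fsubst0 // => [|i]; last first.
  move: i; apply: forall_cat => i; rewrite /W ?vcat_l ?vcat_r /fcomp.
    by rewrite /zpart rel fibre_field_F fsubst0.
  apply: fD_fsubst0 => // j; by rewrite fD_var /c1 vcat_r.
rewrite subr0 fDM fsubstD // !fsubstM // rho_s0 mulr0 add0r fsubstA //.
by rewrite comp_Zv.
Qed.

Let U := fsubst (fderiv (rshift n ord_max) Q') W.

(** The same with [c2], which kills h(Z) and the components of Fbar: only the derivative of [Q'] in
    its last variable survives, with factor [Jb]. *)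
Lemma Jb_on_M :
  fsubst U s0 * fsubst Jb (vsnoc chiA 0) = - (b * fsubst (fD c2 (rho Q)) s0).
Proof.
have rel k : fD c2 (fsubst (hb k) Yv) = fsubst (fD cb (hb k)) Yv.
  by apply: fD_related => // i; rewrite fD_var /c2 vcat_r.
have relZ k : fD c2 (fsubst (h k) Zv) = 0.
  by apply: fD_fsubst0 => // j; rewrite fD_var /c2 vcat_l.
have := congr1 (fun f => - fsubst (fD c2 f) s0) relation_eval.
rewrite /= fDB relZ sub0r fsubstN // opprK.
have -> : fD c2 (fsubst Q' W) = U * fsubst Jb Yv.
  rewrite fD_fsubst // (bigD1 (rshift n ord_max)) //= big1 => [|i].
    by rewrite addr0 /W vcat_r /fcomp rel.
  move: i; apply: forall_cat => i; rewrite /W ?vcat_l ?vcat_r /fcomp.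
    by rewrite /zpart relZ mulr0.
  move: i; apply: forall_snoc => [j _|]; last by rewrite eqxx.
  rewrite rel /hb /fmap_conj -fconj_fD.
  by rewrite fibre_field_F rmorph0 fsubst0 // mulr0.
rewrite fDM (fsubstD vs0) !(fsubstM vs0) rho_s0 mulr0 add0r.
rewrite [fsubst (fsubst Jb _) _](fsubstA _ vYv vs0).
by rewrite comp_Yv.
Qed.

(** For [zeta = 0] the series [rho Q] reduces to w, so only the w-component of [c0] remains. *)
Lemma k1_e1 : fsubst (fsubst (fD c1 (rho Q)) s0) e1 = d0.
Proof.
rewrite fsubstA // s0_e1 -fsubstA // -(fD_related (c := c0)) //; last first.
  apply: forall_cat => i; rewrite /g1 /c1 ?vcat_l ?vcat_r ?fD0 ?fsubst0 //.
  by rewrite fD_var /fcomp fsubstA // comp_Zv // fsubst_id.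
rewrite rho_pt // -vsnoc0 (nQ.2) //; last exact: vanish0_zpart.
by rewrite subr0 fD_var /c0 vsnoc_max det_Jac_z0.
Qed.

Let conj_z0 (f : fps n.+1 C) : fsubst (fconj f) z0 = fconj (fsubst f z0).
Proof.
rewrite fsubst_conj0; congr (fconj (fsubst _ (vsnoc _ _))).
by apply: funext => i; rewrite fconj_var.
Qed.

(** For [Z = 0] the series [rho Q] reduces to [- tau]. *)
Lemma k2_e2 : fsubst (fsubst (fD c2 (rho Q)) s0) e2 = - fconj d0.
Proof.
rewrite fsubstA // s0_e2 -fsubstA // -(fD_related (c := cb)) //; last first.
  apply: forall_cat => i; rewrite /g2 /c2 ?vcat_l ?vcat_r ?fD0 ?fsubst0 //.
  by rewrite fD_var /fcomp fsubstA // comp_Yv // fsubst_id.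
rewrite rho_pt // (nQ.1) //.
by rewrite fDB fD0 sub0r fD_var fsubstN // /cb /c0 vsnoc_max conj_z0 det_Jac_z0.
Qed.

(** Differentiate the normality identity Q'(0, chi, tau) = tau in tau. *)
Lemma u_e2 : fsubst (fsubst U s0) e2 = 1.
Proof.
rewrite fsubstA // s0_e2 /U fsubstA; [|by []|exact: vanish0_fcomp].
have gz : fcomp g2 z0 = vcat (fun=> 0) z0.
  rewrite /g2 fcomp_vcat fcomp0 //; congr vcat.
  by apply: funext => i; rewrite /fcomp fsubst_var.
have vgz : vanish0 (vcat (fun _ : 'I_n.+1 => 0 : fps n C) z0) by exact: vanish0_vcat.
have vhz : vanish0 (fcomp hb z0) by exact: vanish0_fcomp.
have -> : fcomp W (fcomp g2 z0) = fcomp (vcat (fun=> 0) (@fvar C n.+1)) (fcomp hb z0).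
  rewrite gz /W !fcomp_vcat !fcompA // comp_Zv // comp_Yv // fcomp0 //.
  congr vcat; apply: funext => i; first by rewrite /fcomp fcomp_at0 //; exact: vh.
  exact: esym (fsubst_var i vhz).
have vg3 : vanish0 (vcat (fun _ : 'I_n => 0) (@fvar C n.+1)) by exact: vanish0_vcat.
rewrite -fsubstA //.
suff -> : fsubst (fderiv (rshift n ord_max) Q') (vcat (fun=> 0) (@fvar C n.+1)) = 1.
  by rewrite fsubst1.
have /(congr1 (fderiv ord_max)) := nQ'.1 _ (@fvar C n.+1) (@vanish0_var C n.+1).
rewrite fderiv_var eqxx (fderiv_fsubst _ _ vg3) (bigD1 (rshift n ord_max)) //= big1 => [|i].
  by rewrite addr0 vcat_r fderiv_var eqxx mulr1.
move: i; apply: forall_cat => i; rewrite ?vcat_l ?vcat_r ?fderiv0 ?mulr0 //.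
by rewrite fderiv_var (inj_eq (@rshift_inj _ _)) eq_sym => /negPf ->; rewrite mulr0.
Qed.

Lemma nondegenerate_unit : fconst a != 0.
Proof.
have vzR : vanish0 (vsnoc zA (RA Q)) by exact: vanish0_vsnoc.
have vchi : vanish0 (vsnoc chiA 0) by exact: vanish0_vsnoc.
have db0 : fconj d0 != 0 by rewrite fconj_eq0.
set J0 := fsubst J z0.
have J0E : J0 = fsubst b e1 * d0.
  rewrite -k1_e1 -fsubstM // -J_on_M fsubstA // fcomp_vsnoc fcomp_zA //.
  by rewrite fsubst_RA // (nQ.2).
have JbE : Jb = fconj J by rewrite /Jb /hb /fmap_conj -fconj_fD.
have Jchi : fsubst Jb (vsnoc chiA 0) = fsubst (fconj J0) chiA.
  rewrite /J0 -conj_z0 -JbE [RHS](fsubstA _ vz0 (@vanish0_chiA R n)).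
  rewrite /z0 fcomp_vsnoc fsubst0; last exact: vanish0_chiA.
  congr (fsubst _ (vsnoc _ _)).
  by apply: funext => j; rewrite /fcomp fsubst_var.
have chi_e2 : fcomp chiA e2 = @fvar C n by rewrite fcomp_chiA.
have Jb0E : fconj J0 = fsubst b e2 * fconj d0.
  have := congr1 (fun f => fsubst f e2) Jb_on_M.
  rewrite /= fsubstM // fsubstN // fsubstM // u_e2 k2_e2 mul1r mulrN opprK => <-.
  by rewrite Jchi fsubstA // chi_e2 fsubst_id.
(* If [b] were zero, J would vanish on the graph [w = R(z, chi)]; as R is nonzero and R(z, 0) = 0,
   this forces [J = 0]. *)
have b_neq0 : b != 0.
  apply: contraNneq J_neq0 => b0.
  pose s : 'I_(n.+1 + n.+1) -> fps n.+1 C := pt (zpart (@fvar C n.+1)) 0 (fun=> 0) 0.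
  have vs : vanish0 s by apply: vanish0_pt => //; exact: vanish0_zpart.
  apply/eqP/(@fsubst_graph_eq0 _ _ _ ord_max _ (vsnoc zA (RA Q)) s) => //.
  - by rewrite vsnoc_max.
  - move=> i; rewrite fcomp_vsnoc fcomp_zA // fsubst_RA // (nQ.2) //; last exact: vanish0_zpart.
    move: i; apply: forall_snoc => [j|]; rewrite /fmask ?vsnoc_max ?vsnoc_lift /= ?eqxx //.
    by rewrite eq_sym (negPf (neq_lift _ _)).
  - by rewrite J_on_M b0 mul0r.
have k2_neq0 : fsubst (fD c2 (rho Q)) s0 != 0.
  by apply: contraNneq db0 => k0; rewrite -oppr_eq0 -k2_e2 k0 fsubst0.
have J0_neq0 : J0 != 0.
  apply/eqP => J00; move/eqP: Jb_on_M; rewrite Jchi J00 rmorph0 (fsubst0 (@vanish0_chiA R n)) mulr0.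
  by rewrite eq_sym oppr_eq0 mulf_eq0 (negPf b_neq0) (negPf k2_neq0).
have be1 : fsubst b e1 != 0.
  by apply: contraNneq J0_neq0 => be; rewrite J0E be mul0r.
rewrite -(fconst_fsubst a vs0) -/b.
have chi_mask : fmask C (@chi_var n) = fcomp e2 chiA.
  rewrite mask_chi /e2 fcomp_pt fcomp0 // fsubst0 //; congr (pt _ _ _ _).
  by apply: funext => j; rewrite /fcomp fsubst_var.
have z_mask : fmask C (@z_var n) = fcomp e1 zA.
  rewrite mask_z /e1 fcomp_pt fcomp0 // fsubst0 //; congr (pt _ _ _ _).
  by apply: funext => j; rewrite /fcomp fsubst_var.
(* [Jb_on_M], with Jbar(chi, 0) replaced by b(0, chi) times the conjugate of [d0], is the relation
   whose orders in chi are compared. *)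
apply: (@chi_order_const_neq0 (fsubst U s0) b (- fsubst (fD c2 (rho Q)) s0)
  (fsubst (fconj d0) chiA)).
- rewrite mulrN -Jb_on_M Jchi Jb0E (fsubstM (@vanish0_chiA R n)); congr (_ * (_ * _)).
  by rewrite chi_mask fsubstA.
- by rewrite chi_mask fsubstN -?fsubstA // ?k2_e2 -?fsubstN ?opprK //; exact: vanish0_fcomp.
- apply: contraNneq db0 => dchi.
  by rewrite -[fconj d0]fsubst_id -chi_e2 -(fsubstA _ (@vanish0_chiA R n) ve2) dchi fsubst0.
- apply: contraNneq be1 => bz.
  have -> : e1 = fcomp (fmask C (@z_var n)) e1.
    rewrite mask_z fcomp_pt fcomp_zA // fsubst0 // fcomp0 //.
  by rewrite -fsubstA // bz fsubst0.
Qed.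

End Nondegenerate.


(** * Changes of coordinates *)

Lemma fconstM (K : comNzRingType) n (f g : fps n K) :
  fconst (f * g) = fconst f * fconst g.
Proof. exact: rmorphM. Qed.

Lemma sum_lshift (V : nmodType) a b (F : 'I_(a + b) -> V) :
  (forall i, F (rshift a i) = 0) -> \sum_i F i = \sum_i F (lshift b i).
Proof. by move=> F0; rewrite big_split_ord /= [X in _ + X]big1 ?addr0. Qed.

Lemma fconstD (K : comNzRingType) n (f g : fps n K) :
  fconst (f + g) = fconst f + fconst g.
Proof. by []. Qed.

Lemma fconst_sum (K : comNzRingType) n I (r : seq I) (P : pred I)
    (F : I -> fps n K) :
  fconst (\sum_(i <- r | P i) F i) = \sum_(i <- r | P i) fconst (F i).
Proof. exact: raddf_sum. Qed.

(** * Transfer between coordinate systems *)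

Section Transfer.
Variables (R : realType).
Local Notation C := R[i].

Lemma fmap_conj_comp N (g f : 'I_N -> fps N C) :
  fmap_conj (fcomp g f) = fcomp (fmap_conj g) (fmap_conj f).
Proof. by apply: funext => i; rewrite /fmap_conj /fcomp fconj_fsubst. Qed.

Lemma fmap_conj_var N : fmap_conj (@fvar C N) = @fvar C N.
Proof. by apply: funext => i; rewrite /fmap_conj fconj_var. Qed.

Lemma vanish0_varZ N : vanish0 (@varZ R N).
Proof. by move=> i; exact: fconst_var. Qed.

Lemma vanish0_varzeta N : vanish0 (@varzeta R N).
Proof. by move=> i; exact: fconst_var. Qed.
Hint Resolve vanish0_varZ vanish0_varzeta : core.

Lemma fprod_map_comp N (g gb f fb : 'I_N -> fps N C) :
  vanish0 g -> vanish0 gb -> vanish0 f -> vanish0 fb ->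
  fcomp (fprod_map g gb) (fprod_map f fb) = fprod_map (fcomp g f) (fcomp gb fb).
Proof.
move=> vg vgb vf vfb.
rewrite {2}/fprod_map fprod_map_pt; [|exact: vanish0_fcomp..].
by rewrite -!fcompA.
Qed.

Lemma fprod_map_var N : fprod_map (@fvar C N) (@fvar C N) = @fvar C (N + N).
Proof.
by apply/esym/vcat_eq => i; rewrite /fcomp fsubst_var.
Qed.

Lemma in_ideal_refl n (f : fps n C) : in_ideal f f.
Proof. by exists 1; rewrite mul1r. Qed.

Variable n : nat.
Implicit Types M : hypersurface R n.+1.

Lemma normal_coord_Q M Z Q : normal_coord M Z Q -> normal_Q Q.
Proof. by case=> h0 h1 _; apply: normal_QP. Qed.

Lemma vanish0_in_coord (Z Z' : coord_change R n.+1) H :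
  vanish0 H -> vanish0 (in_coord Z Z' H).
Proof.
move=> vH; apply: vanish0_fcomp; first exact: cc_inv0.
by apply: vanish0_fcomp => //; exact: cc0.
Qed.

(** The defining series in the two coordinate systems differ by multipliers [k] and [v]. The new
    multiplier [a] contains a composite of [A] as a factor, so its constant term is nonzero only if
    that of [A] is. *)
Lemma sends_normal M M' Z Q Z' Q' H A :
  normal_coord M Z Q -> normal_coord M' Z' Q' -> vanish0 H ->
  fsubst M' (fprod_map H (fmap_conj H)) = A * (M : fps _ _) ->
  exists a, fsubst (rho Q') (fprod_map (in_coord Z Z' H) (fmap_conj (in_coord Z Z' H)))
              = a * rho Q /\ (fconst a != 0 -> fconst A != 0).
Proof.
move=> [_ _ idM] [_ _ idM'] vH eH; set h := in_coord Z Z' H.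
have vh : vanish0 h by exact: vanish0_in_coord.
have [k ek] := (idM _).1 (in_ideal_refl _).
have [v ev] := (idM' _).2 (in_ideal_refl _).
have vZ : vanish0 Z := cc0 Z; have vZ' : vanish0 Z' := cc0 Z'.
have vc (f : 'I_n.+1 -> fps n.+1 C) : vanish0 f -> vanish0 (fmap_conj f).
  exact: vanish0_fmap_conj.
have vT (f : 'I_n.+1 -> fps n.+1 C) : vanish0 f -> vanish0 (fprod_map f (fmap_conj f)).
  by move=> vf; apply: vanish0_fprod_map => //; exact: vc.
have Z'h : fcomp Z' h = fcomp H Z.
  rewrite /h /in_coord -fcompA; first last.
  - exact: vanish0_fcomp.
  - exact: cc_inv0.
  rewrite (_ : fcomp Z' (cc_inv Z') = @fvar C n.+1); last exact/funext/ccK.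
  by apply: funext => i; rewrite /fcomp fsubst_var //; apply: vanish0_fcomp.
have comp (g f : 'I_n.+1 -> fps n.+1 C) : vanish0 g -> vanish0 f ->
    fcomp (fprod_map g (fmap_conj g)) (fprod_map f (fmap_conj f)) =
    fprod_map (fcomp g f) (fmap_conj (fcomp g f)).
  by move=> vg vf; rewrite fprod_map_comp ?fmap_conj_comp //; exact: vc.
exists (fsubst v (fprod_map h (fmap_conj h)) * fsubst A (fprod_map Z (fmap_conj Z)) * k).
split; last first.
  rewrite !fconstM fconst_fsubst; last exact: vT.
  rewrite fconst_fsubst; last exact: vT.
  by apply: contraNneq => ->; rewrite mulr0 mul0r.
rewrite [rho Q']ev fsubstM; last exact: vT.
rewrite -!mulrA; congr (_ * _); rewrite -ek.
rewrite fsubstA; [|exact: vT..].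
rewrite (comp _ _ vZ' vh) Z'h -(comp _ _ vH vZ) -fsubstA; [|exact: vT..].
by rewrite eH (fsubstM (vT _ vZ)).
Qed.

Lemma fderiv_at_w0 (f : fps n.+1 C) (j : 'I_n) :
  fderiv j (fsubst f (vsnoc (@fvar C n) 0)) =
  fsubst (fderiv (lift ord_max j) f) (vsnoc (@fvar C n) 0).
Proof.
rewrite fderiv_fsubst; last exact: vanish0_vsnoc.
rewrite (bigD1_ord ord_max) //= vsnoc_max fderiv0 mulr0 add0r.
rewrite (bigD1 j) //= big1 => [|k kj].
  by rewrite vsnoc_lift fderiv_var eqxx mulr1 addr0.
by rewrite vsnoc_lift fderiv_var eq_sym (negPf kj) mulr0.
Qed.

(** As [f] maps [w = 0] into itself, the w-derivative of [g] drops out of the chain rule along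
    [w = 0]; the matrices [Fz0] multiply, and so do their determinants. *)
Lemma det_Fz0_comp_eq0 (g f : 'I_n.+1 -> fps n.+1 C) : vanish0 f ->
  fsubst (f ord_max) (vsnoc (@fvar C n) 0) = 0 ->
  \det (Fz0 g) = 0 \/ \det (Fz0 f) = 0 -> \det (Fz0 (fcomp g f)) = 0.
Proof.
move=> vf fw0; have vz0 : vanish0 (vsnoc (@fvar C n) 0) by exact: vanish0_vsnoc.
pose f0 j := fsubst (f (lift ord_max j)) (vsnoc (@fvar C n) 0).
have vf0 : vanish0 f0 by move=> j; rewrite fconst_fsubst.
suff -> : \det (Fz0 (fcomp g f)) = fsubst (\det (Fz0 g)) f0 * \det (Fz0 f).
  by case=> ->; rewrite ?fsubst0 // ?mul0r ?mulr0.
rewrite fsubst_det // -det_mulmx; congr (\det _).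
have fz0 : fcomp f (vsnoc (@fvar C n) 0) = fcomp (vsnoc (@fvar C n) 0) f0.
  rewrite fcomp_vsnoc fsubst0 //; apply: vsnoc_eq => [j|] //.
  by rewrite /fcomp fsubst_var.
apply/matrixP => i j; rewrite !mxE /mapF /fcomp fderiv_fsubst // fsubst_sum //.
rewrite (bigD1_ord ord_max) //= fsubstM // -fderiv_at_w0 fw0 fderiv0 mulr0 add0r.
apply: eq_bigr => k _; rewrite !mxE fsubstM //; congr (_ * _).
by rewrite fsubstA // fz0 -fsubstA.
Qed.

Lemma in_coord_source (Z1 Z2 Z' : coord_change R n.+1) H : vanish0 H ->
  in_coord Z2 Z' H = fcomp (in_coord Z1 Z' H) (fcomp (cc_inv Z1) Z2).
Proof.
move=> vH; have v1 := @cc0 _ _ Z1; have v2 := @cc0 _ _ Z2.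
have v1' := @cc_inv0 _ _ Z1.
have v3 : vanish0 (fcomp (cc_inv Z1) Z2) by exact: vanish0_fcomp.
have vHZ1 : vanish0 (fcomp H Z1) by exact: vanish0_fcomp.
rewrite /in_coord (fcompA _ vHZ1 v3) (fcompA _ v1 v3) -(fcompA Z1 v1' v2).
rewrite (funext (ccK Z1)).
do 2![congr fcomp]; apply: funext => i.
by rewrite /fcomp fsubst_var.
Qed.

Lemma in_coord_target (Z Z1 Z2 : coord_change R n.+1) H : vanish0 H ->
  in_coord Z Z2 H = fcomp (fcomp (cc_inv Z2) Z1) (in_coord Z Z1 H).
Proof.
move=> vH; have v1 := @cc0 _ _ Z1; have v2 := @cc0 _ _ Z.
have v1' := @cc_inv0 _ _ Z1.
have v3 : vanish0 (fcomp H Z) by exact: vanish0_fcomp.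
have v4 : vanish0 (fcomp (cc_inv Z1) (fcomp H Z)) by exact: vanish0_fcomp.
rewrite /in_coord (fcompA _ v1 v4).
congr fcomp; rewrite -(fcompA _ v1' v3) (funext (ccK Z1)).
by apply: funext => i; rewrite [RHS]/fcomp fsubst_var.
Qed.

(** At 0 the Z-gradient of the equation is [fconst A] times that of M, hence nonzero. So the image
    of dH is not contained in the hyperplane [T10 M'], and together they span the whole space. *)
Lemma CR_transversal_unit M M' (H : 'I_n.+1 -> fps n.+1 C) A : vanish0 H ->
  fsubst M' (fprod_map H (fmap_conj H)) = A * (M : fps _ _) ->
  fconst A != 0 -> CR_transversal M' H.
Proof.
move=> vH eH A0.
have vT : vanish0 (fprod_map H (fmap_conj H)).
  by apply: vanish0_fprod_map => //; exact: vanish0_fmap_conj.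
have grad : (jacobian0 H)^T *m dZ0 M' = fconst A *: dZ0 M.
  apply/colP => j; rewrite !mxE.
  have := congr1 (fun f => fconst (fderiv (lshift n.+1 j) f)) eH.
  rewrite fderivM fconstD !fconstM hdef0 mulr0 add0r => <-.
  rewrite fderiv_fsubst // fconst_sum sum_lshift => [|i].
    apply: eq_bigr => i _; rewrite !mxE fconstM fconst_fsubst //.
    have -> : fderiv (lshift n.+1 j) (fprod_map H (fmap_conj H) (lshift n.+1 i)) =
        fsubst (fderiv j (H i)) (@varZ R n.+1).
      rewrite /fprod_map vcat_l /fcomp fderiv_fsubst // (bigD1 j) //= big1 => [|k kj].
        by rewrite addr0 fderiv_var eqxx mulr1.
      by rewrite /varZ fderiv_var (inj_eq (@lshift_inj _ _)) eq_sym (negPf kj) mulr0.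
    by rewrite mulrC fconst_fsubst.
  rewrite fconstM /fprod_map vcat_r /fcomp fderiv_fsubst // big1 ?rmorph0 ?mulr0 // => k _.
  by rewrite /varzeta fderiv_var eq_lrshift mulr0.
have d0 : dZ0 M != 0.
  have [i di] := hdef_dZ M; apply: contraNneq di => d0.
  by move/colP: d0 => /(_ i); rewrite !mxE => ->.
have nk : ~~ ((jacobian0 H)^T <= T10 M')%MS.
  by rewrite sub_kermx grad scalemx_eq0 (negPf A0).
rewrite /CR_transversal submx1 sub1mx -col_leq_rank /=.
have lt : (T10 M' < T10 M' + (jacobian0 H)^T)%MS.
  by rewrite /ltmx addsmxSl addsmx_sub submx_refl.
(* [T10 M'] has codimension at most one, so a strictly larger subspace is everything. *)
apply: leq_trans (rank_ltmx lt); rewrite mxrank_ker.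
have := rank_leq_col (dZ0 M'); lia.
Qed.

End Transfer.

(* The ambient dimension is N = n.+1. *)
Theorem theorem2p2 (R : realType) (n : nat) (M M' : hypersurface R n.+1)
    (H : 'I_n.+1 -> fps n.+1 R[i]) :
  (2 <= n.+1)%N ->
  class_C M ->
  vanish0 H ->
  sends M M' H ->
  ~ transversally_flat M M' H ->
  ~ totally_degenerate M M' H /\ CR_transversal M' H.
Proof.
move=> n1 [Z1 [Q1 [nM1 [k0 rk]]]] vH [A eH] nflat.
have rankQ : full_Qrank Q1.
  case: n n1 => [//|n'] _ in M M' H Z1 Q1 nM1 rk vH A eH nflat *.
  have [s [t st]] := generic_rank_full (rk k0 (leqnn _)).
  by exists (fun i => bmnm (s i)), t.
have [Z2 [Q2 [Z2' [Q2' [nM2 nM2' G2]]]]] : exists Z Q Z' Q',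
    [/\ normal_coord M Z Q, normal_coord M' Z' Q' & mapG (in_coord Z Z' H) <> 0].
  apply: contrapT => nex; apply: nflat => Z Q Z' Q' nMZ nMZ'.
  by apply: contrapT => G; apply: nex; exists Z, Q, Z', Q'.
(* Source coordinates from the class condition, target coordinates from nonflatness. *)
set h := in_coord Z1 Z2' H.
have vh : vanish0 h by exact: vanish0_in_coord.
have nQ1 := normal_coord_Q nM1; have nQ2' := normal_coord_Q nM2'.
have [a [ea aA]] := sends_normal nM1 nM2' vH eH.
have Gh : h ord_max <> 0.
  move=> Gh; apply: G2; rewrite /mapG (in_coord_source Z1 _ _ vH).
  rewrite /fcomp -/h Gh fsubst0 //; apply: vanish0_fcomp; [exact: cc_inv0|exact: cc0].
have detF : \det (Fz0 h) != 0.
  apply/eqP => dF; apply: Gh; exact: (degenerate_mapG0 nQ1 nQ2' vh ea rankQ dF).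
split; last first.
  apply: (CR_transversal_unit vH eH); apply: aA.
  apply: (nondegenerate_unit nQ1 nQ2' vh ea _ _ detF); last exact/eqP.
  exact: RA_neq0.
move=> [Z3 [Q3 [Z3' [Q3' [nM3 nM3' d3]]]]].
case/eqP: detF.
(* The change between the normal coordinates [Z1] and [Z3] of M is the identity map read in them, so
   [mapG_w0] shows that it preserves [w = 0]. Degeneracy thus passes to the source coordinates [Z1],
   and then to the target coordinates [Z2']. *)
have vid := @vanish0_var R[i] n.+1.
have eid : fsubst M (fprod_map (@fvar _ _) (fmap_conj (@fvar _ _))) = 1 * (M : fps _ _).
  by rewrite fmap_conj_var fprod_map_var fsubst_id mul1r.
have [a1 [ea1 _]] := sends_normal nM1 nM3 vid eid.
have vpsi := vanish0_in_coord Z1 Z3 vid.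
have psi0 := mapG_w0 (normal_coord_Q nM1) (normal_coord_Q nM3) vpsi ea1 (@vanish0_var R[i] n).
have psiE : in_coord Z1 Z3 (@fvar _ _) = fcomp (cc_inv Z3) Z1.
  rewrite /in_coord; congr fcomp; apply: funext => i.
  by rewrite /fcomp fsubst_var //; exact: cc0.
have d1 : \det (Fz0 (in_coord Z1 Z3' H)) = 0.
  rewrite (in_coord_source Z3 Z1 Z3' vH) -psiE.
  by apply: (det_Fz0_comp_eq0 vpsi psi0); left.
have [a3 [ea3 _]] := sends_normal nM1 nM3' vH eH.
have vh3 := vanish0_in_coord Z1 Z3' vH.
have h30 := mapG_w0 nQ1 (normal_coord_Q nM3') vh3 ea3 (@vanish0_var R[i] n).
rewrite /h (in_coord_target Z1 Z3' Z2' vH).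
by apply: (det_Fz0_comp_eq0 vh3 h30); right.
Qed.
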